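(* Let $f(x,y)=y^{n}+a_{1}(x)y^{n-1}+\cdots+a_{n}(x)\in\mathbb{C}[x,y]$ with $\deg a_i\leqslant i$ for $i=1,\dots,n$ and $n>1$, and let $\lambda_0\in\mathbb{C}$. Let $D\in\mathbb{N}$ (a positive integer) and functions $\beta_1,\dots,\beta_n,\gamma_1,\dots,\gamma_{n-1}$, meromorphic at infinity, be such that $\deg\beta_i\leqslant D$, $\deg\gamma_j\leqslant D$ for all $i,j$, and $$f(t^{D},y)-\lambda_{0}=\prod_{i=1}^{n}(y-\beta_{i}(t)),\qquad f_{y}^{\prime}(t^{D},y)=n\prod_{j=1}^{n-1}(y-\gamma_{j}(t)).$$ If $\mathcal{L}_{\infty}(f-\lambda_{0},f_{y}^{\prime})<0$, then $$\mathcal{L}_{\infty,\lambda_{0}}(f)+1=\frac{1}{D}\min_{1\leqslant i\leqslant n}\Bigl(\sum_{j=1,\,j\neq i}^{n}\deg(\beta_{i}-\beta_{j})+\min_{1\leqslant j\leqslant n,\,j\neq i}\deg(\beta_{i}-\beta_{j})\Bigr).$$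
   Context: Here $f_y'=\partial f/\partial y$ and $\nabla f=(f_x',f_y')$. For a polynomial mapping $F:\mathbb{C}^{2}\to\mathbb{C}^{m}$, the Łojasiewicz exponent at infinity $\mathcal{L}_\infty(F)$ is the supremum of the set of $\nu\in\mathbb{R}$ for which there are $A,B>0$ with $|F(z)|\geqslant A|z|^{\nu}$ for all $z\in\mathbb{C}^2$, $|z|>B$ (and $-\infty$ if this set is empty); $|\cdot|$ is the maximum norm. $\mathcal{L}_{\infty}(f-\lambda_{0},f_{y}^{\prime})$ is the exponent of the mapping $(f-\lambda_0,f_y'):\mathbb{C}^2\to\mathbb{C}^2$. A function meromorphic at infinity is given by a Laurent series $\sum_{m=k}^{-\infty}c_mt^m$, $k\in\mathbb{Z}$, convergent in a punctured neighbourhood of $\infty\in\overline{\mathbb{C}}$; its degree $\deg$ is the largest $m$ with $c_m\ne0$, $\deg 0:=-\infty$; for a tuple of such functions, $\deg$ is the maximum of the degrees of the components. For $\lambda\in\mathbb{C}$, $$\mathcal{L}_{\infty,\lambda}(f):=\inf_{\Phi}\frac{\deg(\nabla f\circ\Phi)}{\deg\Phi},$$ the infimum taken over all pairs $\Phi=(\varphi_1,\varphi_2)$ of functions meromorphic at infinity with $\deg\Phi>0$ and $\deg((f-\lambda)\circ\Phi)<0$. All values are in $\mathbb{R}\cup\{-\infty\}$ with the usual conventions. *)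

(* Defs.v *)
From HB Require Import structures.
From mathcomp Require Import all_boot all_order all_algebra.
From mathcomp Require Import complex.
From mathcomp Require Import all_classical all_reals all_analysis.

Set Implicit Arguments.
Unset Strict Implicit.
Unset Printing Implicit Defensive.

Import Order.TTheory GRing.Theory Num.Theory.
Import numFieldNormedType.Exports.

Local Open Scope classical_set_scope.
Local Open Scope ring_scope.
Local Open Scope complex_scope.

Section Defs.
Variable R : realType.
Local Notation C := R[i].

(* The real-valued modulus on C: [`|z|] itself lives in C. *)
Definition modulus (z : C) : R := complex.Re `|z|.

Definition near_infty (P : C -> Prop) : Prop :=
  exists2 r : R, 0 < r & forall t : C, r < modulus t -> P t.

(* C[x,y] is {poly {poly C}} with y the outer and x the inner variable; hence
   the y-derivative of f is f^`(). *)
Definition eval2 (f : {poly {poly C}}) (x y : C) : C := f.[y%:P].[x].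

Definition derivx (f : {poly {poly C}}) : {poly {poly C}} :=
  map_poly (@deriv C) f.

Definition mapnorm (m : nat) (F : m.-tuple {poly {poly C}}) (x y : C) : R :=
  \big[Num.max/0]_(i < m) modulus (eval2 (tnth F i) x y).

Definition lojasiewicz_infty (m : nat) (F : m.-tuple {poly {poly C}}) : \bar R :=
  ereal_sup [set nu%:E | nu in [set nu : R |
    exists A B : R, [/\ 0 < A, 0 < B &
      forall x y : C, B < Num.max (modulus x) (modulus y) ->
        A * (Num.max (modulus x) (modulus y)) `^ nu <= mapnorm F x y]]].

(* A function meromorphic at infinity is represented by a total function
   C -> C, only whose values near infinity matter. [laurent_infty phi c] says
   that phi is there the sum of the Laurent series sum_{m <= k} c_m t^m;
   R[i]^o is R[i] with the topology of its norm. *)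
Definition laurent_infty (phi : C -> C) (c : int -> C) : Prop :=
  exists2 k : int, (forall m : int, k < m -> c m = 0) &
    near_infty (fun t => series (fun j : nat =>
      (c (k - j%:Z) * t ^ (k - j%:Z) : C^o)) @ \oo --> (phi t : C^o)).

Definition meromorphic_infty (phi : C -> C) : Prop :=
  exists c : int -> C, laurent_infty phi c.

(* The Laurent expansion being unique and its exponents bounded above, the
   supremum below is a maximum, except for the zero germ, where it is the
   supremum -oo of the empty set. Only meaningful for meromorphic phi. *)
Definition mdeg (phi : C -> C) : \bar R :=
  ereal_sup [set (m%:~R : R)%:E | m in [set m : int |
    exists2 c : int -> C, laurent_infty phi c & c m != 0]].

Definition mdeg2 (phi1 phi2 : C -> C) : \bar R := maxe (mdeg phi1) (mdeg phi2).

Definition comp2 (f : {poly {poly C}}) (phi1 phi2 : C -> C) : C -> C :=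
  fun t => eval2 f (phi1 t) (phi2 t).

Definition lojasiewicz_infty_at (f : {poly {poly C}}) (lambda : C) : \bar R :=
  ereal_inf [set q | exists phi1 phi2 : C -> C,
    [/\ meromorphic_infty phi1, meromorphic_infty phi2,
        (0 < mdeg2 phi1 phi2)%E,
        (mdeg (comp2 (f - lambda%:P%:P) phi1 phi2) < 0)%E &
        q = (mdeg2 (comp2 (derivx f) phi1 phi2) (comp2 f^`() phi1 phi2)
             / mdeg2 phi1 phi2)%E]].

End Defs.

(* Main.v *)
(** Put [g = f - lambda0], [d_ij = deg (beta_i - beta_j)], [S_i = sum_(j != i) d_ij],
    [m_i = min_(j != i) d_ij] and [M = min_i (S_i + m_i)].

    Comparing a point [y] with the root [beta_i t] nearest to it shows that
    either [|g (t^D, y)| >= c |t|^(S_i + m_i)] or [|f_y (t^D, y)| >= c |t|^S_i].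
    So a nonnegative [M] would make the Lojasiewicz exponent of [(g, f_y)]
    nonnegative; hence [M < 0].

    Lower bound: let [Phi = (phi1, phi2)] be a curve with [g o Phi -> 0].  As [f]
    is monic in [y] with [deg a_i <= i], [deg Phi = deg phi1 =: e].  Substituting
    [t := (phi1 t)^(1/D)] above, either [f_y o Phi] has degree at least
    [e S_i / D >= e (M / D - 1)], or [g o Phi] has degree at least [e M / D]; in the
    latter case the chain rule bounds this negative degree by [deg (grad f o Phi) + e].

    Upper bound: between two close roots [beta_i], [beta_l] of [g] with [d_il = m_i]
    there is a root [gamma_j] of [f_y] at distance [O(|beta_i - beta_l|)] (a complex
    Rolle theorem).  Along [Phi = (t^D, gamma_j)] the degree of [g] is at most
    [S_i + m_i] and [f_y] vanishes, so the chain rule gives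
    [deg (grad f o Phi) <= S_i + m_i - D]. *)

Require Import Defs.
From HB Require Import structures.
From mathcomp Require Import all_boot all_order all_algebra.
From mathcomp Require Import complex.
From mathcomp Require Import all_classical all_reals all_analysis.
From mathcomp Require Import ring lra zify.

Set Implicit Arguments.
Unset Strict Implicit.
Unset Printing Implicit Defensive.

Import Order.TTheory GRing.Theory Num.Theory.
Import numFieldNormedType.Exports.

Local Open Scope classical_set_scope.
Local Open Scope ring_scope.
Local Open Scope complex_scope.

(** * The modulus as a real-valued absolute value, and the filter of neighbourhoods of infinity *)

Section Modulus.
Variable R : realType.
Local Notation C := R[i].
Implicit Types (x y z : C).

(** Everything is done with inequalities between powers of |t| near infinity; no derivative of a
    germ is ever formed. A Laurent series enters through two estimates: phi t^-d is close to its
    leading coefficient, and it is Lipschitz in 1/t. Degrees then become two-sided growth bounds,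
    and the derivative in the chain rule becomes the increment from t to t (1 + t^-N), with N so
    large that second-order terms are negligible. The substitution t := phi1(t)^(1/D) need not yield
    a germ: the root separation estimate holds at every t of large modulus and for all y, so any
    pointwise choice of the root will do, and the resulting inequalities are raised to the power D.
    The complex Rolle theorem yields an index j that depends on t; since degrees are integers and
    the indices finite in number, one j can be fixed. If two roots beta_i and beta_j coincide near
    infinity, both sides are [-oo] and the upper bound alone suffices. *)

Lemma modulusE z : `|z| = (modulus z)%:C.
Proof. by rewrite /modulus normc_def. Qed.

Lemma modulus_ge0 z : 0 <= modulus z.
Proof. by rewrite -lecR -modulusE normr_ge0. Qed.
Hint Resolve modulus_ge0 : core.

Lemma modulus0 : modulus 0 = 0 :> R.
Proof. by rewrite /modulus normr0. Qed.

Lemma modulus1 : modulus 1 = 1 :> R.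
Proof. by rewrite /modulus normr1. Qed.

Lemma modulusM x y : modulus (x * y) = modulus x * modulus y.
Proof.
by apply: (@complexI R); rewrite rmorphM /= -!modulusE normrM.
Qed.

Lemma modulusV x : modulus x^-1 = (modulus x)^-1.
Proof. by apply: (@complexI R); rewrite fmorphV /= -!modulusE normfV. Qed.

Lemma modulusX x n : modulus (x ^+ n) = modulus x ^+ n.
Proof. by apply: (@complexI R); rewrite rmorphXn /= -!modulusE normrX. Qed.

Lemma modulusXz x (n : int) : modulus (x ^ n) = modulus x ^ n.
Proof.
by case: n => n; rewrite ?NegzE -?exprnN ?modulusV -?exprnP modulusX.
Qed.

Lemma modulusN x : modulus (- x) = modulus x.
Proof. by rewrite /modulus normrN. Qed.

Lemma modulusB x y : modulus (x - y) = modulus (y - x).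
Proof. by rewrite /modulus distrC. Qed.

Lemma modulusD x y : modulus (x + y) <= modulus x + modulus y.
Proof. by rewrite -lecR rmorphD /= -!modulusE ler_normD. Qed.

Lemma modulusBD x y : modulus (x - y) <= modulus x + modulus y.
Proof. by rewrite -(modulusN y) modulusD. Qed.

Lemma modulus_ge_sub x y : modulus x - modulus y <= modulus (x - y).
Proof. by rewrite lerBlDr -{1}(subrK y x) modulusD. Qed.

Lemma modulus_eq0 x : (modulus x == 0) = (x == 0).
Proof.
by rewrite -[RHS]normr_eq0 modulusE -(inj_eq (@complexI R)).
Qed.

Lemma modulus_gt0 x : (0 < modulus x) = (x != 0).
Proof. by rewrite lt_neqAle modulus_ge0 andbT eq_sym modulus_eq0. Qed.

Lemma modulus_nat n : modulus (n%:R) = n%:R :> R.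
Proof. by rewrite /modulus normr_nat -(rmorph_nat (real_complex R)). Qed.

Lemma modulusR (r : R) : 0 <= r -> modulus r%:C = r.
Proof.
by move=> r0; rewrite /modulus ger0_norm // lecR.
Qed.

Lemma modulus_prod (I : Type) (s : seq I) (P : pred I) (F : I -> C) :
  modulus (\prod_(i <- s | P i) F i) = \prod_(i <- s | P i) modulus (F i).
Proof. by elim/big_ind2: _ => [|x r y q <- <-|//]; rewrite ?modulus1 ?modulusM. Qed.

Lemma modulus_sum (I : Type) (s : seq I) (P : pred I) (F : I -> C) :
  modulus (\sum_(i <- s | P i) F i) <= \sum_(i <- s | P i) modulus (F i).
Proof.
elim/big_ind2: _ => [|x r y q xr yq|//]; rewrite ?modulus0 //.
by rewrite (le_trans (modulusD _ _)) // lerD.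
Qed.

Lemma near_infty_proper : ProperFilter (@near_infty R).
Proof.
apply: Build_ProperFilter => [[r r0 /(_ (r + 1)%:C)]|].
  by apply; rewrite modulusR ?ltrDl // addr_ge0 // ltW.
split=> [|P Q [r r0 rP] [s s0 sQ]|P Q PQ [r r0 rP]]; first by exists 1.
- exists (Num.max r s) => [|t]; first by rewrite lt_max r0.
  by rewrite gt_max => /andP[rt st]; split; [exact: rP|exact: sQ].
- by exists r => // t /rP/PQ.
Qed.

Lemma near_infty_gt (r : R) : near_infty (fun t => r < modulus t).
Proof.
exists (Num.max 1 r) => [|t]; first by rewrite lt_max ltr01.
by rewrite gt_max => /andP[].
Qed.

(** Applied with r = 1/2: if |e| <= 1/2 then |t (1 + e)| >= |t| / 2, so perturbed points still lie
    near infinity. *)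
Lemma near_infty_scale (r : R) (P : C -> Prop) : 0 < r -> near_infty P ->
  near_infty (fun t => forall s, r * modulus t <= modulus s -> P s).
Proof.
move=> r0 [q q0 qP]; exists (q / r) => [|t]; first by rewrite divr_gt0.
rewrite ltr_pdivrMr // => qt s rs; apply: qP.
by apply: lt_le_trans rs; rewrite mulrC.
Qed.

(** In the partial order of [R[i]] a positive element is a positive real, so real epsilons
    suffice. *)
Lemma cvg_modulusP (u : nat -> C) (l : C) :
  ((u : nat -> C^o) @ \oo --> (l : C^o)) <->
  (forall e : R, 0 < e -> exists N, forall n, (N <= n)%N -> modulus (u n - l) < e).
Proof.
split.
- move=> /cvgrPdist_lt ul e e0.
  have e0C : 0 < e%:C :> C by rewrite ltcR.
  have [N _ Nul] := ul _ e0C.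
  exists N => n Nn; rewrite modulusB -ltcR -modulusE.
  exact: Nul.
- move=> ul; apply/cvgrPdist_lt => e e0.
  have [r0 eE] : 0 < complex.Re e /\ e = (complex.Re e)%:C.
    by case: e e0 => a b; rewrite ltcE /= => /andP[/eqP -> a0].
  have [N Nul] := ul _ r0.
  exists N => // n /= Nn; rewrite eE.
  by have := Nul n Nn; rewrite modulusB -ltcR -modulusE.
Qed.

End Modulus.
#[local] Hint Extern 0 (is_true (0 <= modulus _)) => exact: modulus_ge0 : core.
#[local] Existing Instance near_infty_proper.

(** * Power series through their partial sums: coefficient bounds, Lipschitz estimate, Cauchy
    product *)

Section PowerSeries.
Variable R : realType.
Local Notation C := R[i].
Implicit Types (u v : nat -> C) (a b : nat -> C) (t w z : C).

Definition tends u (l : C) :=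
  forall e : R, 0 < e -> exists N, forall n, (N <= n)%N -> modulus (u n - l) < e.

Lemma tendsD u v l m : tends u l -> tends v m -> tends (fun n => u n + v n) (l + m).
Proof.
move=> ul vm e e0; have e2 : 0 < e / 2 by rewrite divr_gt0.
have [N Nul] := ul _ e2; have [N' Nvm] := vm _ e2.
exists (maxn N N') => n; rewrite geq_max => /andP[/Nul h1 /Nvm h2].
rewrite opprD addrACA; apply: le_lt_trans (modulusD _ _) _.
by rewrite (splitr e) ltrD.
Qed.

Lemma tends_cst l : tends (fun=> l) l.
Proof. by move=> e e0; exists 0%N => n _; rewrite subrr modulus0. Qed.

Lemma eq_tends u v l : u =1 v -> tends u l -> tends v l.
Proof. by move=> /funext ->. Qed.

Lemma tends_shift i u l : tends (fun n => u (i + n)%N) l <-> tends u l.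
Proof.
split=> ul e /ul[N Nul]; last first.
  by exists N => n Nn; apply: Nul; rewrite (leq_trans Nn) // leq_addl.
exists (i + N)%N => n Nn.
have iN : (i <= n)%N by rewrite (leq_trans _ Nn) // leq_addr.
by rewrite -(subnKC iN) Nul // leq_subRL.
Qed.

Lemma tends_le u v l m (K : R) :
  tends u l -> tends v m -> (forall n, modulus (u n - v n) <= K) ->
  modulus (l - m) <= K.
Proof.
move=> ul vm uv; apply/ler_addgt0Pr => e e0.
have e2 : 0 < e / 2 by rewrite divr_gt0.
have [N Nul] := ul _ e2; have [N' Nvm] := vm _ e2.
pose n := maxn N N'.
have := Nul n (leq_maxl _ _); have := Nvm n (leq_maxr _ _).
have -> : l - m = - (u n - l) + ((u n - v n) + (v n - m)) by ring.
move=> h1 h2; apply: le_trans (modulusD _ _) _; rewrite modulusN.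
apply: le_trans (lerD (lexx _) (modulusD _ _)) _.
have := uv n; lra.
Qed.

Lemma tends_unique u l m : tends u l -> tends u m -> l = m.
Proof.
move=> ul um; apply/eqP; rewrite -subr_eq0 -modulus_eq0 eq_le modulus_ge0 andbT.
by apply: (tends_le ul um) => n; rewrite subrr modulus0.
Qed.

Lemma tends_bounded u l : tends u l -> exists2 K : R, 0 < K & forall n, modulus (u n) <= K.
Proof.
move=> /(_ 1 ltr01)[N Nul].
exists (1 + modulus l + \sum_(i < N) modulus (u i)) => [|n].
  by apply: ltr_wpDr; [exact: sumr_ge0|exact: ltr_wpDr].
case: (ltnP n N) => nN.
  rewrite (bigD1 (Ordinal nN)) //= addrCA lerDl addr_ge0 ?addr_ge0 //.
  by rewrite sumr_ge0.
rewrite -[leLHS]addr0 lerD ?sumr_ge0 //.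
rewrite -(subrK l (u n)) (le_trans (modulusD _ _)) // lerD2r ltW //.
exact: Nul.
Qed.

Lemma geo2_small (K e : R) : 0 < e -> exists N, forall n, (N <= n)%N -> K / 2 ^+ n < e.
Proof.
move=> e0; have [N NK] : exists N : nat, K / e < N%:R.
  exists (Num.bound `|K / e|); apply: le_lt_trans (ler_norm _) _.
  exact: archi_boundP.
exists N => n Nn; rewrite ltr_pdivrMr ?exprn_gt0 // mulrC -ltr_pdivrMr //.
apply: lt_le_trans NK _; apply: (@le_trans _ _ n%:R); first by rewrite ler_nat.
by rewrite -natrX ler_nat ltnW // ltn_expl.
Qed.

Lemma tends_near u v l (K : R) :
  tends u l -> (forall n, modulus (u n - v n) <= K / 2 ^+ n) -> tends v l.
Proof.
move=> ul uv e e0; have e2 : 0 < e / 2 by rewrite divr_gt0.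
have [N Nul] := ul _ e2; have [N' NK] := geo2_small K e2.
exists (maxn N N') => n; rewrite geq_max => /andP[/Nul h1 /NK h2].
have -> : v n - l = (u n - l) - (u n - v n) by ring.
apply: le_lt_trans (modulusBD _ _) _; have := uv n; lra.
Qed.

Lemma tendsM u v l m : tends u l -> tends v m -> tends (fun n => u n * v n) (l * m).
Proof.
move=> ul vm e e0; have [K K0 uK] := tends_bounded ul.
have m0 : 0 < modulus m + 1 by rewrite ltr_wpDl.
have e1 : 0 < e / 2 / K by rewrite !divr_gt0.
have e2 : 0 < e / 2 / (modulus m + 1) by rewrite !divr_gt0.
have [N Nul] := ul _ e2; have [N' Nvm] := vm _ e1.
exists (maxn N N') => n; rewrite geq_max => /andP[/Nul h1 /Nvm h2].
have -> : u n * v n - l * m = u n * (v n - m) + (u n - l) * m by ring.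
apply: le_lt_trans (modulusD _ _) _; rewrite !modulusM (splitr e).
apply: ltr_leD.
  rewrite -[ltRHS](divfK (lt0r_neq0 K0)) [ltRHS]mulrC.
  by rewrite (le_lt_trans (ler_wpM2r _ (uK n))) // ltr_pM2l.
rewrite -[leRHS](divfK (lt0r_neq0 m0)); apply: ler_pM => //; first exact: ltW.
by rewrite lerDl.
Qed.

Definition psum a N w := \sum_(j < N) a j * w ^+ j.

Lemma psum0 a w : psum a 0 w = 0.
Proof. by rewrite /psum big_ord0. Qed.

Lemma psumS a N w : psum a N.+1 w = psum a N w + a N * w ^+ N.
Proof. by rewrite /psum big_ord_recr. Qed.

Lemma psumD a b N w : psum (fun j => a j + b j) N w = psum a N w + psum b N w.
Proof. by rewrite /psum -big_split /=; apply: eq_bigr => j _; rewrite mulrDl. Qed.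

(** Each term is the difference of two consecutive partial sums, and a convergent sequence is
    bounded. *)
Lemma psum_coef_bound a w l : tends (fun N => psum a N w) l ->
  exists2 K : R, 0 < K & forall j, modulus (a j) * modulus w ^+ j <= K.
Proof.
move=> /tends_bounded[K K0 aK]; exists (K + K) => [|j]; first by rewrite addr_gt0.
rewrite -modulusX -modulusM.
have -> : a j * w ^+ j = psum a j.+1 w - psum a j w by rewrite psumS addrC addKr.
by rewrite (le_trans (modulusBD _ _)) // lerD.
Qed.

Lemma geo2_le N : \sum_(j < N) (2 ^+ j)^-1 <= 2 :> R.
Proof.
suff -> : \sum_(j < N) (2 ^+ j)^-1 = 2 - 2 / 2 ^+ N :> R.
  by rewrite gerBl divr_ge0 // exprn_ge0.
elim: N => [|N IH]; first by rewrite big_ord0 expr0 divr1 subrr.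
rewrite big_ord_recr /= IH exprS; field.
by rewrite expf_neq0.
Qed.

(** The estimate j r^(j-1) |w - z|, multiplied by r so that the exponent j - 1 does not occur. *)
Lemma exprB_bound (w z : C) (r : R) j : modulus w <= r -> modulus z <= r ->
  modulus (w ^+ j - z ^+ j) * r <= j%:R * r ^+ j * modulus (w - z).
Proof.
move=> wr zr; have r0 : 0 <= r by apply: le_trans wr.
elim: j => [|j IH]; first by rewrite !expr0 subrr modulus0 !mul0r.
have -> : w ^+ j.+1 - z ^+ j.+1 = w * (w ^+ j - z ^+ j) + (w - z) * z ^+ j.
  by rewrite !exprS; ring.
apply: le_trans (ler_wpM2r r0 (modulusD _ _)) _.
rewrite !modulusM modulusX mulrDl.
have h1 : modulus w * modulus (w ^+ j - z ^+ j) * r <=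
    r * (j%:R * r ^+ j * modulus (w - z)).
  by rewrite -mulrA; apply: ler_pM => //; rewrite mulr_ge0.
have h2 : modulus (w - z) * modulus z ^+ j * r <= modulus (w - z) * r ^+ j * r.
  by rewrite ler_wpM2r // ler_wpM2l // lerXn2r // nnegrE.
apply: le_trans (lerD h1 h2) _.
rewrite -natr1 exprS le_eqVlt; apply/orP; left; apply/eqP; ring.
Qed.

(** On the disk of radius r/4 the j-th term has Lipschitz constant at most (4 K / r) j / 4^j <= (4 K
    / r) / 2^j, and the geometric sum is at most 2. The bound is uniform in N and so passes to the
    limit. *)
Lemma psum_lipschitz a (K r : R) N (w z : C) : 0 < r ->
  (forall j, modulus (a j) * r ^+ j <= K) ->
  modulus w <= r / 4 -> modulus z <= r / 4 ->
  modulus (psum a N w - psum a N z) <= 8 * K / r * modulus (w - z).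
Proof.
move=> r0 aK wr zr.
have K0 : 0 <= K by apply: le_trans (aK 0%N); rewrite expr0 mulr1.
have q0 : 0 < r / 4 by rewrite divr_gt0.
rewrite /psum -sumrB; apply: le_trans (modulus_sum _ _ _) _.
apply: (@le_trans _ _ (\sum_(j < N) (4 * K / r * modulus (w - z)) * (2 ^+ j)^-1)).
  apply: ler_sum => j _; rewrite -mulrBr modulusM.
  rewrite -(ler_pM2r q0) -[leLHS]mulrA.
  apply: le_trans (ler_wpM2l _ (exprB_bound _ wr zr)) _ => //.
  have -> : 4 * K / r * modulus (w - z) / 2 ^+ j * (r / 4) =
      K * (2 ^+ j)^-1 * modulus (w - z).
    by field; rewrite ?expf_neq0 // lt0r_neq0.
  rewrite mulrA ler_wpM2r //.
  have -> : modulus (a j) * (j%:R * (r / 4) ^+ j) =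
      (modulus (a j) * r ^+ j) * (j%:R / 4 ^+ j).
    by rewrite exprMn exprVn; ring.
  apply: ler_pM => //; first by rewrite mulr_ge0 // exprn_ge0 // ltW.
  rewrite (_ : 4 = 2 * 2 :> R); last by ring.
  rewrite exprMn ler_pdivrMr ?mulr_gt0 ?exprn_gt0 // mulrA mulVf ?expf_neq0 //.
  by rewrite mul1r -natrX ler_nat ltnW // ltn_expl.
rewrite -mulr_sumr.
have -> : 8 * K / r * modulus (w - z) = 4 * K / r * modulus (w - z) * 2 by ring.
by rewrite ler_wpM2l ?geo2_le // !mulr_ge0 // invr_ge0 ltW.
Qed.

Lemma psum_tail a (K r : R) M p (w : C) : 0 < r ->
  (forall j, modulus (a j) * r ^+ j <= K) -> modulus w <= r / 4 ->
  modulus (psum a (M + p) w - psum a M w) <= 2 * K / 4 ^+ M.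
Proof.
move=> r0 aK wr.
have K0 : 0 <= K by apply: le_trans (aK 0%N); rewrite expr0 mulr1.
rewrite /psum big_split_ord /= addrAC subrr add0r; apply: le_trans (modulus_sum _ _ _) _.
apply: (@le_trans _ _ (\sum_(j < p) (K / 4 ^+ M) * (2 ^+ j)^-1)).
  apply: ler_sum => j _; rewrite modulusM modulusX.
  apply: (@le_trans _ _ (modulus (a (M + j)%N) * (r / 4) ^+ (M + j))).
    by rewrite ler_wpM2l // lerXn2r ?nnegrE // divr_ge0 // ltW.
  rewrite exprMn mulrA exprVn [4 ^+ (M + _)]exprD invfM -[leRHS]mulrA; apply: ler_pM => //.
  - by rewrite mulr_ge0 // exprn_ge0 // ltW.
  - rewrite ler_wpM2l ?invr_ge0 ?exprn_ge0 // lef_pV2 ?posrE ?exprn_gt0 //.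
    by rewrite lerXn2r ?nnegrE // ler_nat.
rewrite -mulr_sumr [leRHS](_ : _ = K / 4 ^+ M * 2); last by ring.
by rewrite ler_wpM2l ?geo2_le ?divr_ge0 ?exprn_ge0.
Qed.

Definition cauchy_prod a b n := \sum_(i < n.+1) a i * b (n - i)%N.

Lemma psum_cauchy_prod a b N w :
  psum (cauchy_prod a b) N w = \sum_(i < N) a i * w ^+ i * psum b (N - i) w.
Proof.
elim: N => [|N IH]; first by rewrite psum0 big_ord0.
rewrite psumS IH big_ord_recr /= subSn // subnn psumS psum0 add0r.
rewrite /cauchy_prod mulr_suml big_ord_recr /= subnn expr0 mulr1 addrA.
congr (_ + _); last by ring.
rewrite -big_split /=; apply: eq_bigr => i _.
have iN : (i <= N)%N by rewrite ltnW.
have -> : w ^+ N = w ^+ i * w ^+ (N - i) by rewrite -exprD subnKC.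
rewrite subSn // psumS; ring.
Qed.

(** The difference is the sum over i < N of a_i w^i times the part of the series of b between N - i
    and N. Each summand is at most (K / 4^i) (2 K / 4^(N-i)) = 2 K^2 / 4^N, and N <= 2^N. *)
Lemma cauchy_prod_close a b (K r : R) N w : 0 < r ->
  (forall j, modulus (a j) * r ^+ j <= K) -> (forall j, modulus (b j) * r ^+ j <= K) ->
  modulus w <= r / 4 ->
  modulus (psum a N w * psum b N w - psum (cauchy_prod a b) N w) <=
    2 * K ^+ 2 / 2 ^+ N.
Proof.
move=> r0 aK bK wr.
have K0 : 0 <= K by apply: le_trans (aK 0%N); rewrite expr0 mulr1.
rewrite psum_cauchy_prod {1}/psum mulr_suml -sumrB.
apply: le_trans (modulus_sum _ _ _) _.
apply: (@le_trans _ _ (\sum_(i < N) 2 * K ^+ 2 / 4 ^+ N)); last first.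
  rewrite sumr_const card_ord -[leLHS]mulr_natr -[leLHS]mulrA -[leRHS]mulrA.
  rewrite -[leLHS]mulrA !ler_wpM2l ?exprn_ge0 //.
  rewrite (_ : 4 = 2 * 2 :> R); last by ring.
  rewrite exprMn invfM -mulrA ler_piMr ?invr_ge0 ?exprn_ge0 //.
  by rewrite mulrC ler_pdivrMr ?exprn_gt0 // mul1r -natrX ler_nat ltnW // ltn_expl.
apply: ler_sum => i _; rewrite -mulrBr modulusM.
have iN : (i <= N)%N by rewrite ltnW.
have := @psum_tail b K r (N - i) i w r0 bK wr; rewrite subnK // => h1.
have h2 : modulus (a i * w ^+ i) <= K / 4 ^+ i.
  rewrite modulusM modulusX; apply: (@le_trans _ _ (modulus (a i) * (r / 4) ^+ i)).
    by rewrite ler_wpM2l // lerXn2r ?nnegrE // divr_ge0 // ltW.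
  by rewrite exprMn mulrA exprVn ler_wpM2r // invr_ge0 exprn_ge0.
apply: le_trans (ler_pM _ _ h2 h1) _ => //.
have -> : 4 ^+ N = 4 ^+ i * 4 ^+ (N - i) :> R by rewrite -exprD subnKC.
rewrite le_eqVlt; apply/orP; left; apply/eqP; field.
by rewrite !expf_neq0.
Qed.

Lemma tends_cauchy_prod a b (r : R) (l m : C) w : 0 < r ->
  (exists K : R, forall j, modulus (a j) * r ^+ j <= K) ->
  (exists K : R, forall j, modulus (b j) * r ^+ j <= K) ->
  modulus w <= r / 4 ->
  tends (fun N => psum a N w) l -> tends (fun N => psum b N w) m ->
  tends (fun N => psum (cauchy_prod a b) N w) (l * m).
Proof.
move=> r0 [K1 aK] [K2 bK] wr al bm.
pose K := Num.max K1 K2.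
apply: (tends_near (tendsM al bm)) => N.
apply: (@cauchy_prod_close a b K r) => // j.
  by rewrite le_max aK.
by rewrite le_max bK orbT.
Qed.

End PowerSeries.

(** * Laurent series at infinity as power series in 1/t, and the ring of meromorphic germs *)

Section Laurent.
Variable R : realType.
Local Notation C := R[i].
Implicit Types (c : int -> C) (phi psi : C -> C) (t w z : C) (k m d q : int).

Lemma near_infty_neq0 : near_infty (fun t : C => t != 0).
Proof.
by apply: filterS (near_infty_gt 0) => t; rewrite modulus_gt0.
Qed.

(** The factor t^k is split off, which leaves a power series in 1/t. The index k only has to bound
    the exponents; c k may vanish. *)
Definition laurent_at k c phi :=
  near_infty (fun t => tends (fun N => psum (fun j => c (k - j%:Z)) N t^-1)
                             (phi t * t ^ (- k))).

Lemma laurentP phi c : laurent_infty phi c <->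
  exists2 k, (forall m, k < m -> c m = 0) & laurent_at k c phi.
Proof.
have E k t n : t != 0 -> series (fun j => c (k - j%:Z) * t ^ (k - j%:Z)) n =
    t ^ k * psum (fun j => c (k - j%:Z)) n t^-1.
  move=> t0; rewrite /series /= big_mkord mulr_sumr; apply: eq_bigr => j _.
  by rewrite expfzDr // -exprnN exprVn mulrCA.
split=> -[k ck h]; exists k => //; apply: filterS2 near_infty_neq0 h => t t0.
- move=> /cvg_modulusP h; rewrite mulrC.
  apply: (@eq_tends _ (fun n => t ^ (- k) *
    series (fun j => c (k - j%:Z) * t ^ (k - j%:Z)) n)) => [n|].
    by rewrite E // mulrA -expfzDr // addNr expr0z mul1r.
  by apply: tendsM => //; exact: tends_cst.
- move=> h; apply/cvg_modulusP.
  change (tends (series (fun j => c (k - j%:Z) * t ^ (k - j%:Z))) (phi t)).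
  rewrite [phi t](_ : _ = t ^ k * (phi t * t ^ (- k))); last first.
    by rewrite mulrCA -expfzDr // subrr expr0z mulr1.
  apply: (@eq_tends _ (fun n => t ^ k * psum (fun j => c (k - j%:Z)) n t^-1)) => [n|].
    by rewrite E.
  by apply: tendsM => //; exact: tends_cst.
Qed.

Lemma psum_raise c k (i : nat) N w : (forall m, k < m -> c m = 0) ->
  psum (fun j => c (k + i%:Z - j%:Z)) (i + N) w =
  w ^+ i * psum (fun j => c (k - j%:Z)) N w.
Proof.
move=> ck; rewrite /psum big_split_ord /= big1 ?add0r => [|j _]; last first.
  by rewrite ck ?mul0r // -addrA ltrDl subr_gt0 ltz_nat.
rewrite mulr_sumr; apply: eq_bigr => j _.
rewrite exprD mulrCA; have -> : k + i%:Z - (i + j)%N%:Z = k - j%:Z by lia.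
by [].
Qed.

(** Raising k by i prepends i zero coefficients. One direction brings two series to a common k
    before they are added; the other strips vanishing top coefficients. *)
Lemma laurent_at_raise c phi k (i : nat) : (forall m, k < m -> c m = 0) ->
  laurent_at (k + i%:Z) c phi <-> laurent_at k c phi.
Proof.
move=> ck; split; apply: filterS2 near_infty_neq0 => t t0.
- move=> /((tends_shift i _ _).2) h.
  rewrite [_ * _](_ : _ = t ^+ i * (phi t * t ^ (- (k + i%:Z)))); last first.
    by rewrite mulrCA exprnP -expfzDr // opprD addrCA subrr addr0.
  apply: (@eq_tends _ (fun n => t ^+ i * psum (fun j => c (k + i%:Z - j%:Z)) (i + n) t^-1)) => [n|].
    by rewrite psum_raise // mulrA -exprMn divff // expr1n mul1r.
  by apply: tendsM => //; exact: tends_cst.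
- move=> h; apply/(tends_shift i).
  rewrite [_ * _](_ : _ = t^-1 ^+ i * (phi t * t ^ (- k))); last first.
    by rewrite mulrCA exprVn exprnN -expfzDr // opprD addrC.
  apply: (@eq_tends _ (fun n => t^-1 ^+ i * psum (fun j => c (k - j%:Z)) n t^-1)) => [n|].
    by rewrite psum_raise.
  by apply: tendsM => //; exact: tends_cst.
Qed.

Lemma meromorphicP phi : meromorphic_infty phi <->
  exists k c, (forall m, k < m -> c m = 0) /\ laurent_at k c phi.
Proof.
split=> [[c /laurentP[k ck h]]|[k [c [ck h]]]]; first by exists k, c.
by exists c; apply/laurentP; exists k.
Qed.

Lemma near_laurent phi psi c : near_infty (fun t => phi t = psi t) ->
  laurent_infty phi c -> laurent_infty psi c.
Proof.
move=> phipsi /laurentP[k ck h]; apply/laurentP; exists k => //.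
by apply: filterS2 phipsi h => t ->.
Qed.

Lemma near_meromorphic phi psi : near_infty (fun t => phi t = psi t) ->
  meromorphic_infty phi -> meromorphic_infty psi.
Proof. by move=> pp [c /(near_laurent pp)]; exists c. Qed.

Lemma near_mdeg phi psi : near_infty (fun t => phi t = psi t) ->
  mdeg phi = mdeg psi.
Proof.
move=> pp; have pp' : near_infty (fun t => psi t = phi t) by apply: filterS pp.
suff E : laurent_infty phi = laurent_infty psi by rewrite /mdeg E.
by apply/funext => c; apply/propext; split; exact: near_laurent.
Qed.

Lemma meromorphic_monomial (a : C) k : meromorphic_infty (fun t => a * t ^ k).
Proof.
apply/meromorphicP; exists k, (fun m => if m == k then a else 0).
split=> [m km|]; first by rewrite gt_eqF.
apply: filterS near_infty_neq0 => t t0; apply/(tends_shift 1).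
rewrite -mulrA -expfzDr // subrr expr0z mulr1.
apply: (@eq_tends _ (fun=> a)) (tends_cst a) => n.
rewrite /psum big_split_ord /= big_ord1 /= subr0 eqxx expr0 mulr1 big1 ?addr0 //.
move=> j _; rewrite (_ : (_ == _) = false) ?mul0r //.
by apply/eqP; lia.
Qed.

Lemma meromorphic_cst (a : C) : meromorphic_infty (fun=> a).
Proof.
apply: near_meromorphic (meromorphic_monomial a 0).
by apply: filterE => t; rewrite expr0z mulr1.
Qed.

Lemma meromorphicXn n : meromorphic_infty (fun t : C => t ^+ n).
Proof.
apply: near_meromorphic (meromorphic_monomial 1 n).
by apply: filterE => t; rewrite mul1r.
Qed.

Lemma meromorphicD phi psi : meromorphic_infty phi -> meromorphic_infty psi ->
  meromorphic_infty (fun t => phi t + psi t).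
Proof.
move=> /meromorphicP[k1 [c1 [ck1 h1]]] /meromorphicP[k2 [c2 [ck2 h2]]].
pose k := Num.max k1 k2; pose i1 := `|k - k1|%N; pose i2 := `|k - k2|%N.
have kE1 : k = k1 + i1%:Z by rewrite /i1 /k; lia.
have kE2 : k = k2 + i2%:Z by rewrite /i2 /k; lia.
apply/meromorphicP; exists k, (fun m => c1 m + c2 m); split=> [m km|].
  by rewrite ck1 ?ck2 ?addr0 //; apply: le_lt_trans km; rewrite le_max lexx ?orbT.
have := (laurent_at_raise phi i1 ck1).2 h1; have := (laurent_at_raise psi i2 ck2).2 h2.
rewrite -kE1 -kE2; apply: filterS2 => t ht2 ht1.
rewrite mulrDl; apply: eq_tends (tendsD ht1 ht2) => n; exact/esym/psumD.
Qed.

(** The series converges at the real point t = 1/r as soon as 1/r exceeds the radius s of the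
    neighbourhood; [psum_coef_bound] is applied at w = r. *)
Lemma laurent_at_coef_bound k c phi : laurent_at k c phi ->
  exists r0 : R, 0 < r0 /\ forall r, 0 < r -> r <= r0 ->
    exists2 K, 0 < K & forall j : nat, modulus (c (k - j%:Z)) * r ^+ j <= K.
Proof.
case=> s s0 h; exists (s + 1)^-1; split=> [|r r0 rs].
  by rewrite invr_gt0 addr_gt0.
have /h/psum_coef_bound[K K0 cK] : s < modulus (r^-1%:C : C).
  rewrite modulusR ?invr_ge0 1?ltW //; apply: lt_le_trans (_ : s + 1 <= _).
    by rewrite ltrDl.
  by rewrite -[s + 1]invrK lef_pV2 // posrE invr_gt0 addr_gt0.
exists K => // j; have := cK j.
by rewrite modulusV modulusR ?invrK // invr_ge0 ltW.
Qed.

Lemma near_infty_inv (r : R) : 0 < r ->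
  near_infty (fun t : C => modulus t^-1 <= r).
Proof.
move=> r0; apply: filterS (near_infty_gt r^-1) => t rt.
rewrite modulusV -[leRHS]invrK lef_pV2 ?posrE ?invr_gt0 ?(ltW rt) //.
by rewrite (lt_trans _ rt) // invr_gt0.
Qed.

Lemma meromorphicM phi psi : meromorphic_infty phi -> meromorphic_infty psi ->
  meromorphic_infty (fun t => phi t * psi t).
Proof.
move=> /meromorphicP[k1 [c1 [ck1 h1]]] /meromorphicP[k2 [c2 [ck2 h2]]].
pose a j := c1 (k1 - j%:Z); pose b j := c2 (k2 - j%:Z); pose k := k1 + k2.
(* Above k the coefficient has to be set to 0 explicitly, since the absolute value in the index
   would reflect m about k. *)
pose c m := if m <= k then cauchy_prod a b `|k - m|%N else 0.
apply/meromorphicP; exists k, c; split=> [m km|].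
  by rewrite /c leNgt km.
have [r1 [r10 H1]] := laurent_at_coef_bound h1.
have [r2 [r20 H2]] := laurent_at_coef_bound h2.
pose r := Num.min r1 r2; have r0 : 0 < r by rewrite lt_min r10.
have [|K1 _ aK] := H1 r r0; first by rewrite ge_min lexx.
have [|K2 _ bK] := H2 r r0; first by rewrite ge_min lexx orbT.
have r4 : 0 < r / 4 by rewrite divr_gt0.
apply: filterS2 (filterI near_infty_neq0 (near_infty_inv r4)) (filterI h1 h2).
move=> t [t0 tr] [ht1 ht2].
have -> : phi t * psi t * t ^ (- k) = (phi t * t ^ (- k1)) * (psi t * t ^ (- k2)).
  by rewrite opprD expfzDr //; ring.
apply: eq_tends (tends_cauchy_prod r0 _ _ tr ht1 ht2); last 2 first.
- by exists K1.
- by exists K2.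
move=> n; apply: eq_bigr => j _; congr (_ * _).
rewrite /c gerBl //; congr (cauchy_prod _ _ _); lia.
Qed.

Lemma meromorphicN phi : meromorphic_infty phi -> meromorphic_infty (fun t => - phi t).
Proof.
move=> /(meromorphicM (meromorphic_cst (-1))); apply: near_meromorphic.
by apply: filterE => t; rewrite mulN1r.
Qed.

Lemma meromorphicB phi psi : meromorphic_infty phi -> meromorphic_infty psi ->
  meromorphic_infty (fun t => phi t - psi t).
Proof. by move=> hp /meromorphicN; exact: meromorphicD. Qed.

Lemma meromorphic_comp2 (f : {poly {poly C}}) phi psi :
  meromorphic_infty phi -> meromorphic_infty psi -> meromorphic_infty (comp2 f phi psi).
Proof.
move=> hphi hpsi.
have inner (p : {poly C}) : meromorphic_infty (fun t => p.[phi t]).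
  elim/poly_ind: p => [|p a IH].
    by apply: near_meromorphic (meromorphic_cst 0); apply: filterE => t; rewrite horner0.
  apply: near_meromorphic (meromorphicD (meromorphicM IH hphi) (meromorphic_cst a)).
  by apply: filterE => t; rewrite !hornerE.
rewrite /comp2 /eval2; elim/poly_ind: f => [|p a IH].
  by apply: near_meromorphic (meromorphic_cst 0); apply: filterE => t; rewrite !horner0.
apply: near_meromorphic (meromorphicD (meromorphicM IH hpsi) (inner a)).
by apply: filterE => t; rewrite !hornerE.
Qed.

(** Both estimates are instances of [psum_lipschitz]: the first compares 1/t with 0, the second 1/s
    with 1/t. Requiring |1/t| <= r/8 keeps |1/s| <= 2 |1/t| inside the disk of radius r/4. *)
Lemma laurent_germ k c phi : laurent_at k c phi -> exists L : R, [/\ 0 < L,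
  near_infty (fun t => modulus (phi t * t ^ (- k) - c k) <= L / modulus t) &
  near_infty (fun t => forall s, 2^-1 * modulus t <= modulus s ->
    modulus (phi s * s ^ (- k) - phi t * t ^ (- k)) <= L * modulus (s^-1 - t^-1))].
Proof.
move=> h; have [r [r0 /(_ r r0 (lexx _))[K K0 cK]]] := laurent_at_coef_bound h.
have r8 : 0 < r / 8 by rewrite divr_gt0.
have hL := psum_lipschitz _ r0 cK.
exists (8 * K / r); split; first by rewrite !divr_gt0 // mulr_gt0.
- apply: filterS2 (near_infty_inv r8) h => t tr /((tends_shift 1 _ _).2) ht.
  rewrite -modulusV -[t^-1 in leRHS]subr0.
  apply: (tends_le ht (tends_cst _)) => n.
  have {1}-> : c k = psum (fun j => c (k - j%:Z)) (1 + n) 0.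
    rewrite /psum big_split_ord /= big_ord1 /= subr0 expr0 mulr1 big1 ?addr0 //.
    by move=> j _; rewrite expr0n mulr0.
  by apply: hL; rewrite ?modulus0; lra.
- have h2 : 0 < 2^-1 :> R by rewrite invr_gt0.
  apply: filterS3 (filterI near_infty_neq0 (near_infty_inv r8)) h (near_infty_scale h2 h).
  move=> t [t0 tr] ht hs s ts; apply: (tends_le (hs s ts) ht) => n.
  apply: hL; last by lra.
  have t0' : 0 < 2^-1 * modulus t by rewrite mulr_gt0 // modulus_gt0.
  apply: (@le_trans _ _ (2 * modulus t^-1)); last by lra.
  rewrite !modulusV -[2 in leRHS]invrK -invfM lef_pV2 // posrE //.
  exact: lt_le_trans ts.
Qed.

End Laurent.

(** * The degree of a meromorphic germ as its order of growth *)

Section Degree.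
Variable R : realType.
Local Notation C := R[i].
Implicit Types (c : int -> C) (phi psi : C -> C) (t w z : C) (k m d q : int).

(** If q < d, the inequality would give A |t| <= K, which fails beyond K / A. *)
Lemma near_pow_le (A K : R) d q : 0 < A ->
  near_infty (fun t : C => A * modulus t ^ d <= K * modulus t ^ q) -> d <= q.
Proof.
move=> A0 h; rewrite leNgt; apply/negP => qd.
have [t [/andP[t1 tK] ht]] : exists t : C,
    (1 < modulus t) && (K / A < modulus t) /\ A * modulus t ^ d <= K * modulus t ^ q.
  apply: (@filter_ex _ _ (near_infty_proper R)).
  apply: filterS3 (near_infty_gt 1) (near_infty_gt (K / A)) h => t -> ->; split=> //.
have t0 : 0 < modulus t by rewrite (lt_trans _ t1).
have : A * modulus t <= K.
  rewrite -(ler_pM2r (exprz_gt0 q t0)); apply: le_trans ht.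
  rewrite -mulrA ler_pM2l // -[X in X * _]expr1z -expfzDr ?gt_eqF //.
  rewrite ler_weXz2l ?(ltW t1) //; lia.
by rewrite leNgt mulrC -ltr_pdivrMr // tK.
Qed.

Lemma near_pow_le0 (A : R) d : 0 < A ->
  ~ near_infty (fun t : C => A * modulus t ^ d <= 0).
Proof.
move=> A0 h; have : near_infty (fun t : C => A * modulus t ^ d <= 0 * modulus t ^ (d - 1)).
  by apply: filterS h => t; rewrite mul0r.
by move=> /(near_pow_le A0); rewrite lerBrDr gerDl.
Qed.

(** A nonzero germ of degree d with leading coefficient a. The Lipschitz condition in 1/t is what
    stands in for differentiability. *)
Definition germ d (a : C) (L : R) phi := [/\ a != 0, 0 < L,
  near_infty (fun t => modulus (phi t * t ^ (- d) - a) <= L / modulus t) &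
  near_infty (fun t => forall s, 2^-1 * modulus t <= modulus s ->
    modulus (phi s * s ^ (- d) - phi t * t ^ (- d)) <= L * modulus (s^-1 - t^-1))].

Definition growth_le q phi := exists2 K : R, 0 < K &
  near_infty (fun t => modulus (phi t) <= K * modulus t ^ q).

Definition growth_ge q phi := exists2 A : R, 0 < A &
  near_infty (fun t => A * modulus t ^ q <= modulus (phi t)).

Lemma germ_bounds d a L phi : germ d a L phi -> growth_le d phi /\ growth_ge d phi.
Proof.
move=> [a0 L0 h _]; have a0' : 0 < modulus a by rewrite modulus_gt0.
have H : near_infty (fun t => modulus (phi t * t ^ (- d) - a) <= modulus a / 2 /\
   (0 < modulus t /\ modulus (phi t) = modulus (phi t * t ^ (- d)) * modulus t ^ d)).
  apply: filterS3 (near_infty_neq0 R) (near_infty_gt (2 * L / modulus a)) h => t t0 tL ht.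
  have tp : 0 < modulus t by rewrite modulus_gt0.
  split; last first.
    by rewrite -modulusXz -modulusM -mulrA -expfzDr // addNr expr0z mulr1.
  apply: le_trans ht _; rewrite ler_pdivrMr //.
  by move: tL; rewrite ltr_pdivrMr // => tL; nra.
split.
- exists (2 * modulus a); first by rewrite mulr_gt0.
  apply: filterS H => t [h1 [t0 ->]]; rewrite ler_wpM2r ?exprz_ge0 //.
  have := modulusD (phi t * t ^ (- d) - a) a; rewrite subrK; lra.
- exists (modulus a / 2); first by rewrite divr_gt0.
  apply: filterS H => t [h1 [t0 ->]]; rewrite ler_wpM2r ?exprz_ge0 //.
  have := modulusBD (phi t * t ^ (- d)) (phi t * t ^ (- d) - a).
  by rewrite subKr; lra.
Qed.

Lemma growth_le_ge d q phi : growth_le q phi -> growth_ge d phi -> d <= q.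
Proof.
move=> [K K0 hK] [A A0 hA]; apply: near_pow_le A0 _.
by apply: filterS2 hA hK => t; exact: le_trans.
Qed.

Lemma laurent_cases c phi : laurent_infty phi c ->
  (near_infty (fun t => phi t = 0) /\ forall m, c m = 0) \/
  exists d L, germ d (c d) L phi /\ forall m, d < m -> c m = 0.
Proof.
move=> /laurentP[k ck h].
have [[m cm]|c0] := pselect (exists m, c m != 0); last first.
  have c0' m : c m = 0 by apply/eqP/negPn/negP => cm; apply: c0; exists m.
  left; split=> //; apply: filterS2 (near_infty_neq0 R) h => t t0 ht.
  have /eqP : phi t * t ^ (- k) = 0.
    apply: tends_unique ht _; apply: (@eq_tends _ (fun=> 0)); last exact: tends_cst.
    by move=> n; rewrite /psum big1 // => j _; rewrite c0' mul0r.
  by rewrite mulf_eq0 (negPf (expfz_neq0 _ t0)) orbF => /eqP.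
right; pose P (j : nat) := c (k - j%:Z) != 0.
have exP : exists j, P j.
  have mk : m <= k by rewrite leNgt; apply: contraNN cm => /ck ->.
  by exists `|k - m|%N; rewrite /P (_ : k - _ = m) //; lia.
(* The least i with c (k - i) nonzero marks the top exponent of the series. *)
pose i := ex_minn exP; pose d := k - i%:Z.
have [cd dm] : c d != 0 /\ forall m, d < m -> c m = 0.
  rewrite /d /i; case: ex_minnP => j Pj jmin; split=> // m' jm'.
  have [/ck//|m'k] := ltP k m'.
  apply/eqP/negPn/negP => cm'; have := jmin `|k - m'|%N.
  rewrite /P (_ : k - _ = m'); last by lia.
  by move=> /(_ cm'); lia.
have kE : k = d + i%:Z by rewrite /d subrK.
move: h; rewrite kE => /(laurent_at_raise phi i dm).1 /laurent_germ[L [L0 h1 h2]].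
by exists d, L; split.
Qed.

(** Any expansion of phi has a top exponent that is also its order of growth, hence equals d. The
    uniqueness of the top exponent is all that the supremum in [mdeg] requires. *)
Lemma mdeg_germ d a L phi : meromorphic_infty phi -> germ d a L phi ->
  mdeg phi = (d%:~R)%:E.
Proof.
move=> [c cphi] ga; have [Od Omd] := germ_bounds ga.
have top c' : laurent_infty phi c' ->
    c' d != 0 /\ forall m, d < m -> c' m = 0.
  move=> /laurent_cases[[phi0 _]|[d' [L' [ga' h]]]].
    case: Omd => A A0 hA; case: (@near_pow_le0 A d A0).
    by apply: filterS2 phi0 hA => t ->; rewrite modulus0.
  have [Od' Omd'] := germ_bounds ga'.
  have dd' : d = d'.
    by apply: le_anti; rewrite (growth_le_ge Od' Omd) (growth_le_ge Od Omd').
  by rewrite dd'; split=> //; case: ga'.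
apply/eqP; rewrite eq_le; apply/andP; split.
- apply: ge_ereal_sup => _ [m [c' /top[_ h] cm] <-]; rewrite lee_fin ler_int leNgt.
  by apply: contraNN cm => /h ->.
- by apply: ereal_sup_ubound; exists d => //; exists c => //; case: (top _ cphi).
Qed.

Lemma mdeg_near0 phi : near_infty (fun t => phi t = 0) -> mdeg phi = -oo%E.
Proof.
move=> phi0; rewrite /mdeg (_ : [set m | _] = set0) ?image_set0 ?ereal_sup0 //.
rewrite -subset0 => m /= [c /laurent_cases[[_ ->]|[d [L [ga _]]]]]; first by rewrite eqxx.
have [_ [A A0 hA]] := germ_bounds ga; case: (@near_pow_le0 A d A0).
by apply: filterS2 phi0 hA => t ->; rewrite modulus0.
Qed.

Lemma meromorphic_cases phi : meromorphic_infty phi ->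
  (near_infty (fun t => phi t = 0) /\ mdeg phi = -oo%E) \/
  exists d a L, germ d a L phi /\ mdeg phi = (d%:~R)%:E.
Proof.
move=> [c cphi]; case: (laurent_cases cphi) => [[phi0 _]|[d [L [ga _]]]].
  by left; split=> //; exact: mdeg_near0.
by right; exists d, (c d), L; split=> //; apply: mdeg_germ ga; exists c.
Qed.

Lemma le_growth q q' phi : q <= q' -> growth_le q phi -> growth_le q' phi.
Proof.
move=> qq' [K K0 h]; exists K => //.
apply: filterS2 (near_infty_gt 1) h => t t1 /le_trans; apply.
by rewrite ler_pM2l // ler_weXz2l // ltW.
Qed.

Lemma mdeg_leP q phi : meromorphic_infty phi ->
  (mdeg phi <= q%:~R%:E)%E <-> growth_le q phi.
Proof.
move=> /meromorphic_cases[[phi0 ->]|[d [a [L [ga ->]]]]].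
  split=> _; last by rewrite leNye.
  exists 1 => //; apply: filterS phi0 => t ->.
  by rewrite modulus0 mul1r exprz_ge0.
rewrite lee_fin ler_int; have [Od Omd] := germ_bounds ga.
by split=> [dq|Oq]; [exact: le_growth Od|exact: growth_le_ge Oq Omd].
Qed.

Lemma mdeg_geP q phi : meromorphic_infty phi ->
  (q%:~R%:E <= mdeg phi)%E <-> growth_ge q phi.
Proof.
move=> /meromorphic_cases[[phi0 ->]|[d [a [L [ga ->]]]]].
  split=> [//|[A A0 hA]]; case: (@near_pow_le0 A q A0).
  by apply: filterS2 phi0 hA => t ->; rewrite modulus0.
rewrite lee_fin ler_int; have [Od Omd] := germ_bounds ga.
split=> [qd|Oq]; last exact: growth_le_ge Od Oq.
case: Omd => A A0 h; exists A => //.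
apply: filterS2 (near_infty_gt 1) h => t t1; apply: le_trans.
by rewrite ler_pM2l // ler_weXz2l // ltW.
Qed.

Lemma growth_leD q phi psi : growth_le q phi -> growth_le q psi ->
  growth_le q (fun t => phi t + psi t).
Proof.
move=> [K K0 h] [K' K'0 h']; exists (K + K'); first by rewrite addr_gt0.
apply: filterS2 h h' => t ht ht'; apply: le_trans (modulusD _ _) _.
by rewrite mulrDl lerD.
Qed.

(** Degrees being integers, two summands of degree below d are both O(|t|^(d-1)), and so is their
    sum. *)
Lemma mdegD phi psi : meromorphic_infty phi -> meromorphic_infty psi ->
  (mdeg (fun t => (phi t + psi t)%R) <= maxe (mdeg phi) (mdeg psi))%E.
Proof.
move=> mphi mpsi; have mpp := meromorphicD mphi mpsi.
case: (meromorphic_cases mpp) => [[_ ->]|[d [a [L [ga ->]]]]]; first by rewrite leNye.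
rewrite leNgt gt_max; apply/negP => /andP[h1 h2].
have [_ Omd] := germ_bounds ga.
have H chi : meromorphic_infty chi -> (mdeg chi < d%:~R%:E)%E -> growth_le (d - 1) chi.
  move=> mchi hchi; apply/mdeg_leP => //.
  case: (meromorphic_cases mchi) hchi => [[_ ->]|[e [? [? [_ ->]]]]]; first by rewrite leNye.
  by rewrite lte_fin ltr_int lee_fin ler_int; lia.
by have := growth_le_ge (growth_leD (H _ mphi h1) (H _ mpsi h2)) Omd; lia.
Qed.

Lemma mdegM phi psi : meromorphic_infty phi -> meromorphic_infty psi ->
  mdeg (fun t => phi t * psi t) = (mdeg phi + mdeg psi)%E.
Proof.
move=> mphi mpsi; have mpp := meromorphicM mphi mpsi.
case: (meromorphic_cases mphi) => [[p0 ->]|[d [a [L [ga ->]]]]].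
  by rewrite addNye mdeg_near0 //; apply: filterS p0 => t ->; rewrite mul0r.
case: (meromorphic_cases mpsi) => [[p0 ->]|[d' [a' [L' [ga' ->]]]]].
  by rewrite addeNy mdeg_near0 //; apply: filterS p0 => t ->; rewrite mulr0.
have [[K K0 hK] [A A0 hA]] := germ_bounds ga.
have [[K' K'0 hK'] [A' A'0 hA']] := germ_bounds ga'.
apply/eqP; rewrite -EFinD -rmorphD eq_le; apply/andP; split.
- apply/mdeg_leP => //; exists (K * K'); first exact: mulr_gt0.
  apply: filterS3 (near_infty_neq0 R) hK hK' => t t0 h h'.
  rewrite modulusM expfzDr ?modulus_eq0 // mulrACA; exact: ler_pM.
- apply/mdeg_geP => //; exists (A * A'); first exact: mulr_gt0.
  apply: filterS3 (near_infty_neq0 R) hA hA' => t t0 h h'.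
  rewrite modulusM expfzDr ?modulus_eq0 // mulrACA; apply: ler_pM => //.
  + by rewrite mulr_ge0 ?exprz_ge0 // ltW.
  + by rewrite mulr_ge0 ?exprz_ge0 // ltW.
Qed.

End Degree.

(** * Increments of a germ from t to t (1 + e), in place of its logarithmic derivative *)

Section Differences.
Variable R : realType.
Local Notation C := R[i].
Implicit Types (phi psi : C -> C) (t e w z : C) (d q : int).

Lemma expr1D_taylor (n : nat) : exists2 K : R, 0 <= K & forall e : C,
  modulus e <= 2^-1 -> modulus ((1 + e) ^+ n - 1 - n%:R * e) <= K * modulus e ^+ 2.
Proof.
elim: n => [|n [K K0 IH]].
  by exists 0 => // e _; rewrite expr0 subrr mul0r subrr modulus0 mul0r.
exists (2 * K + n%:R) => [|e e2]; first by rewrite addr_ge0 ?mulr_ge0.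
have -> : (1 + e) ^+ n.+1 - 1 - n.+1%:R * e =
    (1 + e) * ((1 + e) ^+ n - 1 - n%:R * e) + n%:R * e ^+ 2.
  by rewrite exprS -natr1; ring.
apply: le_trans (modulusD _ _) _.
rewrite modulusM [modulus (n%:R * _)]modulusM modulusX modulus_nat mulrDl lerD2r.
rewrite -mulrA.
apply: ler_pM => //; last exact: IH.
by apply: le_trans (modulusD _ _) _; rewrite modulus1; lra.
Qed.

Lemma modulus1D_ge e : modulus e <= 2^-1 -> 2^-1 <= modulus (1 + e).
Proof.
move=> e2; have := modulusBD (1 + e) e; rewrite addrK modulus1; lra.
Qed.

(** For a negative exponent -n put P = (1 + e)^n: then P^-1 - 1 + n e = P^-1 (n e (P - 1) - (P - 1 -
    n e)), where |P^-1| <= 2^n and the bracket is of second order by the positive case. *)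
Lemma expz1D_taylor d : exists2 K : R, 0 <= K & forall e : C,
  modulus e <= 2^-1 -> modulus ((1 + e) ^ d - 1 - d%:~R * e) <= K * modulus e ^+ 2.
Proof.
case: d => n; first exact: expr1D_taylor.
rewrite NegzE; have [K K0 h] := expr1D_taylor n.+1.
exists (2 ^+ n.+1 * (K + n.+1%:R * (n.+1%:R + K))) => [|e e2].
  by rewrite mulr_ge0 ?exprn_ge0 // addr_ge0 // mulr_ge0 // addr_ge0.
have e1 := modulus1D_ge e2.
have ne : 1 + e != 0 by rewrite -modulus_gt0 (lt_le_trans _ e1) // invr_gt0.
set P := (1 + e) ^+ n.+1; have P0 : P != 0 by rewrite expf_neq0.
have {h} := h e e2; rewrite -/P => h.
rewrite -exprnN -/P.
have -> : P^-1 - 1 - (- n.+1%:Z)%:~R * e =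
    P^-1 * (n.+1%:R * e * (P - 1) - (P - 1 - n.+1%:R * e)).
  by rewrite mulrNz -pmulrn; field.
rewrite modulusM -[leRHS]mulrA; apply: ler_pM => //.
  rewrite modulusV modulusX -[leRHS]invrK lef_pV2 ?posrE ?invr_gt0 ?exprn_gt0 ?modulus_gt0 //.
  by rewrite -exprVn lerXn2r // nnegrE.
apply: le_trans (modulusBD _ _) _; rewrite mulrDl addrC; apply: lerD => //.
rewrite !modulusM modulus_nat -[leRHS]mulrA -[leLHS]mulrA; apply: ler_pM => //.
  by rewrite mulr_ge0.
have -> : (n.+1%:R + K) * modulus e ^+ 2 = modulus e * ((n.+1%:R + K) * modulus e) by ring.
apply: ler_wpM2l => //.
rewrite -(subrK (n.+1%:R * e) (P - 1)); apply: le_trans (modulusD _ _) _.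
rewrite modulusM modulus_nat mulrDl addrC lerD2l.
apply: le_trans h _; rewrite expr2 ler_wpM2l // ler_piMr //.
by apply: le_trans e2 _; lra.
Qed.

Lemma expz1D_le d : exists2 K : R, 0 <= K & forall e : C,
  modulus e <= 2^-1 -> modulus ((1 + e) ^ d - 1) <= K * modulus e.
Proof.
have [K K0 h] := expz1D_taylor d; exists (modulus (d%:~R : C) + K).
  exact: addr_ge0.
move=> e e2; rewrite -(subrK (d%:~R * e) (_ - 1)); apply: le_trans (modulusD _ _) _.
rewrite modulusM mulrDl addrC lerD2l; apply: le_trans (h e e2) _.
rewrite expr2 ler_wpM2l // ler_piMr //; lra.
Qed.

(** A nonzero integer has modulus at least 1, so the linear term d e is at least |e|; for |e| <= 1 /
    (2 (K + 1)) the quadratic remainder takes away at most half of it. *)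
Lemma expz1D_ge d : d != 0 -> exists2 r : R, 0 < r <= 2^-1 & forall e : C,
  modulus e <= r -> 2^-1 * modulus e <= modulus ((1 + e) ^ d - 1).
Proof.
move=> d0; have [K K0 h] := expz1D_taylor d.
have K1 : 0 < 2 * (K + 1) by rewrite mulr_gt0 // ltr_wpDl.
have rK : (2 * (K + 1))^-1 <= 2^-1 by rewrite lef_pV2 ?posrE //; lra.
exists (2 * (K + 1))^-1; first by rewrite invr_gt0 K1.
move=> e er; have {}h := h e (le_trans er rK).
have d1 : 1 <= modulus (d%:~R : C).
  rewrite /modulus -intr_norm -(rmorph_int (real_complex R)) /= ler1z; lia.
have h1 := modulus_ge_sub (d%:~R * e) (- ((1 + e) ^ d - 1 - d%:~R * e)).
move: h1; rewrite (_ : _ - - _ = (1 + e) ^ d - 1); last by ring.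
rewrite modulusN modulusM => h1.
apply: le_trans h1; have : K * modulus e ^+ 2 <= 2^-1 * modulus e.
  rewrite expr2 mulrA ler_wpM2r //; apply: le_trans (ler_wpM2l K0 er) _.
  by rewrite ler_pdivrMr //; lra.
have := ler_wpM2r (modulus_ge0 e) d1; lra.
Qed.

(** With s = t (1 + e), phi(s) - phi(t) is the sum of phi(s) s^-d (s^d - t^d), comparable to a t^d
    ((1 + e)^d - 1), and of (phi(s) s^-d - phi(t) t^-d) t^d, which the Lipschitz condition makes
    smaller by a factor 1/|t|. *)
Lemma germ_perturb d a L phi : germ d a L phi ->
  near_infty (fun t => forall e, modulus e <= 2^-1 ->
    [/\ t * (1 + e) != 0, modulus (phi (t * (1 + e)) -
           phi (t * (1 + e)) * (t * (1 + e)) ^ (- d) * (t ^ d * ((1 + e) ^ d - 1)) - phi t)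
        <= 2 * L * modulus e / modulus t * modulus t ^ d &
      modulus a / 2 <= modulus (phi (t * (1 + e)) * (t * (1 + e)) ^ (- d)) <= 2 * modulus a]).
Proof.
move=> [a0 L0 h1 h2]; have a0' : 0 < modulus a by rewrite modulus_gt0.
have i2 : 0 < 2^-1 :> R by rewrite invr_gt0.
apply: filterS3 (filterI (near_infty_neq0 R) (near_infty_gt (4 * L / modulus a)))
  (near_infty_scale i2 h1) h2 => t [t0 tL] ht1 ht2 e e2.
have e1 := modulus1D_ge e2.
have ne : 1 + e != 0 by rewrite -modulus_gt0 (lt_le_trans _ e1).
have tp : 0 < modulus t by rewrite modulus_gt0.
set s := t * (1 + e); have s0 : s != 0 by rewrite mulf_neq0.
have ts : 2^-1 * modulus t <= modulus s by rewrite modulusM mulrC ler_wpM2l.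
split=> //.
- have -> : phi s - phi s * s ^ (- d) * (t ^ d * ((1 + e) ^ d - 1)) - phi t =
      (phi s * s ^ (- d) - phi t * t ^ (- d)) * t ^ d.
    have -> : t ^ d * ((1 + e) ^ d - 1) = s ^ d - t ^ d.
      by rewrite mulrBr mulr1 /s expfzMl.
    rewrite [RHS]mulrBl mulrBr -![_ * _ ^ (- d) * _]mulrA -!expfzDr // !addNr !expr0z.
    by ring.
  rewrite modulusM modulusXz ler_wpM2r ?exprz_ge0 //.
  apply: le_trans (ht2 s ts) _.
  have -> : s^-1 - t^-1 = - (t^-1 * (1 + e)^-1 * e).
    by rewrite /s; field; rewrite ne.
  rewrite modulusN !modulusM !modulusV.
  have -> : 2 * L * modulus e / modulus t = L * ((modulus t)^-1 * 2 * modulus e) by ring.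
  rewrite ler_wpM2l ?(ltW L0) // ler_wpM2r // ler_wpM2l ?invr_ge0 //.
  by rewrite -[leRHS]invrK lef_pV2 // posrE (lt_le_trans _ e1).
- have {}ht1 := ht1 s ts.
  have sL : L / modulus s <= modulus a / 2.
    rewrite ler_pdivrMr ?modulus_gt0 //; move: tL; rewrite ltr_pdivrMr // => tL.
    by have := ler_wpM2l (ltW a0') ts; lra.
  have := modulusD (phi s * s ^ (- d) - a) a; rewrite subrK.
  have := modulusBD (phi s * s ^ (- d)) (phi s * s ^ (- d) - a); rewrite subKr.
  by move=> ? ?; apply/andP; split; lra.
Qed.

(** Plays the part of the bound t phi'(t) = O(|t|^q). *)
Lemma growth_le_diff q phi : meromorphic_infty phi -> growth_le q phi ->
  exists2 K : R, 0 < K & near_infty (fun t => forall e, modulus e <= 2^-1 ->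
    modulus (phi (t * (1 + e)) - phi t) <= K * modulus e * modulus t ^ q).
Proof.
move=> mphi Oq; case: (meromorphic_cases mphi) => [[p0 _]|[d [a [L [ga _]]]]].
  have i2 : 0 < 2^-1 :> R by rewrite invr_gt0.
  exists 1 => //; apply: filterS2 p0 (near_infty_scale i2 p0) => t -> h e e2.
  rewrite h; last by rewrite modulusM mulrC ler_wpM2l // modulus1D_ge.
  by rewrite subrr modulus0 mulr_ge0 ?exprz_ge0 // mulr_ge0.
have dq : d <= q := growth_le_ge Oq (germ_bounds ga).2.
have [K K0 hK] := expz1D_le d; have L0 : 0 < L by case: ga.
exists (2 * modulus a * K + 2 * L).
  by rewrite ltr_wpDl ?mulr_ge0 // mulr_gt0.
apply: filterS2 (near_infty_gt 1) (germ_perturb ga) => t t1 h e e2.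
have [_ h1 /andP[_ h2]] := h e e2.
set s := t * (1 + e) in h1 h2 *.
set X := phi s * s ^ (- d) * (t ^ d * ((1 + e) ^ d - 1)) in h1.
apply: (@le_trans _ _ ((2 * modulus a * K + 2 * L) * modulus e * modulus t ^ d)); last first.
  rewrite ler_wpM2l ?ler_weXz2l ?(ltW t1) // mulr_ge0 // addr_ge0 ?mulr_ge0 //.
  exact: ltW.
rewrite (_ : phi s - phi t = X + (phi s - X - phi t)); last by ring.
apply: le_trans (modulusD _ _) _.
rewrite [leRHS](_ : _ = 2 * modulus a * (modulus t ^ d * (K * modulus e)) +
    2 * L * modulus e * modulus t ^ d); last by ring.
apply: lerD.
  rewrite /X modulusM [modulus (t ^ d * _)]modulusM modulusXz.
  by apply: ler_pM => //; rewrite ?mulr_ge0 ?exprz_ge0 // ler_wpM2l ?exprz_ge0 ?hK.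
apply: le_trans h1 _; rewrite ler_wpM2r ?exprz_ge0 // ler_piMr ?mulr_ge0 ?(ltW L0) //.
by rewrite invf_le1 ?(lt_trans _ t1) // ltW.
Qed.

(** Plays the part of the statement that t phi'(t) has exact degree d when d is nonzero. The main
    term is at least |a|/4 and the remainder at most |a|/8 times |e| |t|^d, which leaves |a|/8. *)
Lemma mdeg_diff_ge d phi : meromorphic_infty phi -> mdeg phi = d%:~R%:E -> d != 0 ->
  exists2 A : R, 0 < A & exists2 r : R, 0 < r & near_infty (fun t => forall e,
    modulus e <= r -> A * modulus e * modulus t ^ d <= modulus (phi (t * (1 + e)) - phi t)).
Proof.
move=> mphi dphi d0; case: (meromorphic_cases mphi) => [[_]|[d' [a [L [ga]]]]].
  by rewrite dphi.
rewrite dphi => -[/eqP]; rewrite eqr_int => /eqP dd'; subst d'.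
have [r /andP[r0 r2] hr] := expz1D_ge d0.
have [a0 L0 _ _] := ga; have a0' : 0 < modulus a by rewrite modulus_gt0.
exists (modulus a / 8); first by rewrite divr_gt0.
exists r => //.
apply: filterS2 (filterI (near_infty_neq0 R) (near_infty_gt (16 * L / modulus a)))
  (germ_perturb ga) => t [t0 tL] h e er.
have tp : 0 < modulus t by rewrite modulus_gt0.
have [_ h1 /andP[h2 _]] := h e (le_trans er r2).
set s := t * (1 + e) in h1 h2 *.
set X := phi s * s ^ (- d) * (t ^ d * ((1 + e) ^ d - 1)) in h1.
have hX : modulus a / 4 * modulus e * modulus t ^ d <= modulus X.
  rewrite /X modulusM [modulus (t ^ d * _)]modulusM modulusXz.
  have -> : modulus a / 4 * modulus e * modulus t ^ d =
     modulus a / 2 * (modulus t ^ d * (2^-1 * modulus e)) by field.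
  apply: ler_pM => //; first by rewrite divr_ge0.
    by rewrite !mulr_ge0 ?exprz_ge0 ?invr_ge0.
  by rewrite ler_wpM2l ?exprz_ge0 // hr.
have hL : 2 * L * modulus e / modulus t * modulus t ^ d <=
    modulus a / 8 * modulus e * modulus t ^ d.
  rewrite ler_wpM2r ?exprz_ge0 // mulrAC ler_wpM2r // ler_pdivrMr //.
  by move: tL; rewrite ltr_pdivrMr //; lra.
have := modulusBD (phi s - phi t) (phi s - X - phi t).
rewrite (_ : phi s - phi t - (phi s - X - phi t) = X); last by ring.
lra.
Qed.

End Differences.

(** * Second-order Taylor estimate for polynomials in two variables *)

Section Taylor.
Variable R : realType.
Local Notation C := R[i].
Implicit Types (phi psi : C -> C) (f : {poly {poly C}}) (t x y : C) (q : int).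

(** Stated for triples of functions rather than for polynomials, so that it is stable under sums and
    products and an induction on the polynomial applies. The bounds on F, Fx and Fy are carried
    along because the product rule needs them. *)
Definition taylor2 (F Fx Fy : C -> C -> C) := exists K : R, exists N : nat, 0 <= K /\
  forall (B delta : R) (x y x' y' : C), 1 <= B -> 0 <= delta <= 1 ->
    modulus x <= B -> modulus y <= B -> modulus x' <= B -> modulus y' <= B ->
    modulus (x' - x) <= delta -> modulus (y' - y) <= delta ->
  [/\ modulus (F x y) <= K * B ^+ N, modulus (F x' y') <= K * B ^+ N,
      modulus (Fx x y) <= K * B ^+ N, modulus (Fy x y) <= K * B ^+ N &
      modulus (F x' y' - F x y - (Fx x y * (x' - x) + Fy x y * (y' - y)))
        <= K * B ^+ N * delta ^+ 2].

Lemma taylor2_cst (a : C) : taylor2 (fun _ _ => a) (fun _ _ => 0) (fun _ _ => 0).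
Proof.
exists (modulus a), 0%N; split=> // B delta x y x' y' B1 /andP[d0 d1] *.
rewrite expr0 mulr1 subrr !mul0r addr0 subr0 modulus0.
by split=> //; rewrite mulr_ge0 ?exprn_ge0.
Qed.

Lemma taylor2_fst : taylor2 (fun x _ => x) (fun _ _ => 1) (fun _ _ => 0).
Proof.
exists 1, 1%N; split=> // B delta x y x' y' B1 /andP[d0 d1] *.
rewrite expr1 mul1r modulus1 mul1r mul0r addr0 subrr modulus0.
by split=> //; rewrite ?mulr_ge0 ?exprn_ge0 // (le_trans _ B1).
Qed.

Lemma taylor2_snd : taylor2 (fun _ y => y) (fun _ _ => 0) (fun _ _ => 1).
Proof.
exists 1, 1%N; split=> // B delta x y x' y' B1 /andP[d0 d1] *.
rewrite expr1 mul1r modulus1 mul1r mul0r add0r subrr modulus0.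
by split=> //; rewrite ?mulr_ge0 ?exprn_ge0 // (le_trans _ B1).
Qed.

Lemma taylor2D F Fx Fy G Gx Gy : taylor2 F Fx Fy -> taylor2 G Gx Gy ->
  taylor2 (fun x y => F x y + G x y) (fun x y => Fx x y + Gx x y)
          (fun x y => Fy x y + Gy x y).
Proof.
move=> [K1 [N1 [K10 h1]]] [K2 [N2 [K20 h2]]].
exists (K1 + K2), (maxn N1 N2); split; first exact: addr_ge0.
move=> B delta x y x' y' B1 d01 xB yB xB' yB' xd yd.
have [a1 a2 a3 a4 a5] := h1 _ _ _ _ _ _ B1 d01 xB yB xB' yB' xd yd.
have [b1 b2 b3 b4 b5] := h2 _ _ _ _ _ _ B1 d01 xB yB xB' yB' xd yd.
have le1 : K1 * B ^+ N1 <= K1 * B ^+ maxn N1 N2.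
  by rewrite ler_wpM2l // ler_weXn2l // leq_maxl.
have le2 : K2 * B ^+ N2 <= K2 * B ^+ maxn N1 N2.
  by rewrite ler_wpM2l // ler_weXn2l // leq_maxr.
have add u v : modulus u <= K1 * B ^+ N1 -> modulus v <= K2 * B ^+ N2 ->
    modulus (u + v) <= (K1 + K2) * B ^+ maxn N1 N2.
  by move=> hu hv; apply: le_trans (modulusD _ _) _; rewrite mulrDl; lra.
split; try exact: add.
rewrite (_ : _ - _ - _ =
  (F x' y' - F x y - (Fx x y * (x' - x) + Fy x y * (y' - y))) +
  (G x' y' - G x y - (Gx x y * (x' - x) + Gy x y * (y' - y)))); last by ring.
apply: le_trans (modulusD _ _) _.
apply: (@le_trans _ _ (K1 * B ^+ N1 * delta ^+ 2 + K2 * B ^+ N2 * delta ^+ 2)).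
  exact: lerD.
by rewrite -mulrDl ler_wpM2r ?exprn_even_ge0 // mulrDl; lra.
Qed.

Lemma taylor2M F Fx Fy G Gx Gy : taylor2 F Fx Fy -> taylor2 G Gx Gy ->
  taylor2 (fun x y => F x y * G x y)
          (fun x y => Fx x y * G x y + F x y * Gx x y)
          (fun x y => Fy x y * G x y + F x y * Gy x y).
Proof.
move=> [K1 [N1 [K10 h1]]] [K2 [N2 [K20 h2]]].
(* 8 = 1 + 6 + 1: the remainder of F times G', the product of the increments 2 M1 delta and 3 M2
   delta, and F times the remainder of G. *)
exists (8 * (K1 * K2)), (N1 + N2)%N; split; first by rewrite !mulr_ge0.
move=> B delta x y x' y' B1 d01 xB yB xB' yB' xd yd.
have [a1 a2 a3 a4 a5] := h1 _ _ _ _ _ _ B1 d01 xB yB xB' yB' xd yd.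
have [b1 b2 b3 b4 b5] := h2 _ _ _ _ _ _ B1 d01 xB yB xB' yB' xd yd.
have /andP[d0 d1] := d01.
set M1 := K1 * B ^+ N1 in a1 a2 a3 a4 a5; set M2 := K2 * B ^+ N2 in b1 b2 b3 b4 b5.
have -> : 8 * (K1 * K2) * B ^+ (N1 + N2) = 8 * (M1 * M2).
  by rewrite exprD /M1 /M2; ring.
have M10 : 0 <= M1 := le_trans (modulus_ge0 _) a1.
have M20 : 0 <= M2 := le_trans (modulus_ge0 _) b1.
have M12 : 0 <= M1 * M2 by exact: mulr_ge0.
have mul u v : modulus u <= M1 -> modulus v <= M2 -> modulus (u * v) <= M1 * M2.
  by move=> hu hv; rewrite modulusM; apply: ler_pM.
have mul2 u v u' v' : modulus u <= M1 -> modulus v <= M2 -> modulus u' <= M1 ->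
    modulus v' <= M2 -> modulus (u * v + u' * v') <= 8 * (M1 * M2).
  move=> hu hv hu' hv'; apply: le_trans (modulusD _ _) _.
  by have := mul _ _ hu hv; have := mul _ _ hu' hv'; lra.
have sgl u v : modulus u <= M1 -> modulus v <= M2 -> modulus (u * v) <= 8 * (M1 * M2).
  by move=> hu hv; have := mul _ _ hu hv; lra.
split; try exact: sgl; try exact: mul2.
set DF := Fx x y * (x' - x) + Fy x y * (y' - y).
set DG := Gx x y * (x' - x) + Gy x y * (y' - y).
have lin u v (M : R) : modulus u <= M -> modulus v <= M ->
    modulus (u * (x' - x) + v * (y' - y)) <= 2 * M * delta.
  move=> hu hv; apply: le_trans (modulusD _ _) _; rewrite !modulusM.
  have := ler_pM (modulus_ge0 _) (modulus_ge0 _) hu xd.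
  have := ler_pM (modulus_ge0 _) (modulus_ge0 _) hv yd; lra.
have DFle : modulus DF <= 2 * M1 * delta by exact: lin.
have DGle : modulus DG <= 2 * M2 * delta by exact: lin.
have Gle : modulus (G x' y' - G x y) <= 3 * M2 * delta.
  rewrite -(subrK DG (G x' y' - G x y)); apply: le_trans (modulusD _ _) _.
  have : M2 * delta ^+ 2 <= M2 * delta by rewrite ler_wpM2l // expr2 ler_piMl.
  lra.
rewrite (_ : _ - _ - _ = (F x' y' - F x y - DF) * G x' y' +
   (DF * (G x' y' - G x y) + F x y * (G x' y' - G x y - DG))); last first.
  by rewrite /DF /DG; ring.
apply: le_trans (modulusD _ _) _; apply: le_trans (lerD (lexx _) (modulusD _ _)) _.
rewrite !modulusM.
have e1 := ler_pM (modulus_ge0 _) (modulus_ge0 _) a5 b2.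
have e2 := ler_pM (modulus_ge0 _) (modulus_ge0 _) DFle Gle.
have e3 := ler_pM (modulus_ge0 _) (modulus_ge0 _) a1 b5.
apply: le_trans (lerD e1 (lerD e2 e3)) _.
by rewrite le_eqVlt; apply/orP; left; apply/eqP; ring.
Qed.

Lemma eval2D f g x y : eval2 (f + g) x y = eval2 f x y + eval2 g x y.
Proof. by rewrite /eval2 !hornerE. Qed.

Lemma eval2MX f x y : eval2 (f * 'X) x y = eval2 f x y * y.
Proof. by rewrite /eval2 !hornerE. Qed.

Lemma eval2C (p : {poly C}) x y : eval2 p%:P x y = p.[x].
Proof. by rewrite /eval2 !hornerE. Qed.

Lemma derivx_MXaddC f (p : {poly C}) :
  derivx (f * 'X + p%:P) = derivx f * 'X + p^`()%:P.
Proof.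
apply/polyP => i; rewrite /derivx coef_map_id0 ?deriv0 //.
rewrite !coefD !coefMX !coefC coef_map_id0 ?deriv0 // derivD.
by case: i => [|i] /=; rewrite ?deriv0 ?coef_map_id0 ?deriv0.
Qed.

Lemma taylor2_eval2 f : taylor2 (eval2 f) (eval2 (derivx f)) (eval2 f^`()).
Proof.
have ext F Fx Fy G Gx Gy : (forall x y, [/\ F x y = G x y, Fx x y = Gx x y &
    Fy x y = Gy x y]) -> taylor2 F Fx Fy -> taylor2 G Gx Gy.
  move=> E.
  have EF : F = G by apply/funext => x; apply/funext => y; case: (E x y).
  have EFx : Fx = Gx by apply/funext => x; apply/funext => y; case: (E x y).
  have EFy : Fy = Gy by apply/funext => x; apply/funext => y; case: (E x y).
  by move=> TF; move: EF EFx EFy TF => -> -> ->.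
have inner (p : {poly C}) :
    taylor2 (fun x _ => p.[x]) (fun x _ => p^`().[x]) (fun _ _ => 0).
  elim/poly_ind: p => [|p a IH].
    by apply: ext (taylor2_cst 0) => x y; rewrite deriv0 !horner0.
  apply: ext (taylor2D (taylor2M IH taylor2_fst) (taylor2_cst a)) => x y.
  by rewrite derivD derivM derivX derivC !hornerE; split=> //; ring.
elim/poly_ind: f => [|f p IH].
  apply: ext (taylor2_cst 0) => x y.
  by rewrite /derivx map_polyE /= deriv0 /eval2 polyseq0 /= !horner0.
apply: ext (taylor2D (taylor2M IH taylor2_snd) (inner p)) => x y.
rewrite derivx_MXaddC derivD derivM derivX derivC [f * 1]mulr1.
rewrite [_ + f + 0]addr0 !eval2D !eval2MX !eval2C.
by split=> //; ring.
Qed.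

End Taylor.

(** * The chain rule for degrees along a meromorphic curve *)

Section Euler.
Variable R : realType.
Local Notation C := R[i].
Implicit Types (phi psi : C -> C) (f : {poly {poly C}}) (t x y : C) (d e p q : int).

(** The increments of phi and psi are O(|t|^(e-N)), so the Taylor remainder is O(|t|^(e M + 2 (e -
    N))). The exponent gains 2 N while the target q - N loses only N; hence any q is reached once N
    is large. *)
Lemma chain_rule_diff f phi psi e q : meromorphic_infty phi -> meromorphic_infty psi ->
  growth_le e phi -> growth_le e psi -> 0 <= e ->
  exists N0 : nat, forall N : nat, (N0 <= N)%N -> exists2 K : R, 0 < K &
    near_infty (fun t => let s := t * (1 + t ^- N) in
      modulus (comp2 f phi psi s - comp2 f phi psi t -
        (comp2 (derivx f) phi psi t * (phi s - phi t) +
         comp2 f^`() phi psi t * (psi s - psi t))) <= K * modulus t ^ (q - N%:Z)).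
Proof.
move=> mphi mpsi Ophi Opsi e0.
have arith (N M : nat) : (absz e + 2 + absz (e * M%:Z + 2 * e - q)%R <= N)%N ->
    [/\ - N%:Z <= -1, e - N%:Z <= -2, e - N%:Z <= e &
        e * M%:Z + 2 * (e - N%:Z) <= q - N%:Z].
  by split; lia.
have [K1 K10 h1] := growth_le_diff mphi Ophi.
have [K2 K20 h2] := growth_le_diff mpsi Opsi.
have [K3 K30 h3] := Ophi; have [K4 K40 h4] := Opsi.
have [K [M [K0 tay]]] := taylor2_eval2 f.
pose K' := K1 + K2; have K'0 : 0 < K' by rewrite addr_gt0.
pose BK := 1 + K3 + K4 + K'.
have BK1 : 1 <= BK by rewrite /BK -!addrA lerDl !addr_ge0 // ltW.
exists (absz e + 2 + absz (e * M%:Z + 2 * e - q)%R)%N => N /arith[N1 N2 N3 N4].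
exists (K * BK ^+ M * K' ^+ 2 + 1).
  by rewrite ltr_wpDl // !mulr_ge0 ?exprn_ge0 // ?ltW // (lt_le_trans _ BK1).
have l2 : near_infty (fun t : C => 2 < modulus t) := near_infty_gt 2.
apply: filterS2 (filterI (filterI h1 h2) (filterI h3 h4))
  (filterI l2 (near_infty_gt K')) => t [[ht1 ht2] [ht3 ht4]] [t2 tK'] s.
have tp : 0 < modulus t by rewrite (lt_trans _ t2).
have t1 : 1 <= modulus t by rewrite (le_trans _ (ltW t2)) // ler1n.
have te1 : 1 <= modulus t ^ e by rewrite -(expr0z (modulus t)) ler_weXz2l.
have mw : modulus (t ^- N) = modulus t ^ (- N%:Z) by rewrite exprnN modulusXz.
have mw1 : modulus (t ^- N) <= (modulus t)^-1.
  by rewrite mw -[leRHS]exprN1 ler_weXz2l.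
have mw2 : modulus (t ^- N) <= 2^-1.
  by apply: le_trans mw1 _; rewrite lef_pV2 ?posrE // ltW.
have {}ht1 := ht1 _ mw2; have {}ht2 := ht2 _ mw2.
rewrite -/s mw in ht1 ht2.
have eN : modulus t ^ (- N%:Z) * modulus t ^ e = modulus t ^ (e - N%:Z).
  by rewrite -expfzDr ?gt_eqF // addrC.
rewrite -mulrA eN in ht1; rewrite -mulrA eN in ht2.
set delta := K' * modulus t ^ (e - N%:Z).
have pe : 0 <= modulus t ^ (e - N%:Z) by rewrite exprz_ge0.
have d1 : delta <= 1.
  apply: (@le_trans _ _ (modulus t * modulus t ^ (- 2))).
    by apply: ler_pM; rewrite ?ler_weXz2l // ltW.
  by rewrite -[X in X * _]expr1z -expfzDr ?gt_eqF // -(expr0z (modulus t)) ler_weXz2l.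
have d0 : 0 <= delta by rewrite mulr_ge0 // ltW.
have pd : modulus (phi s - phi t) <= delta.
  by apply: le_trans ht1 _; rewrite ler_wpM2r // lerDl ltW.
have qd : modulus (psi s - psi t) <= delta.
  by apply: le_trans ht2 _; rewrite ler_wpM2r // lerDr ltW.
pose B := BK * modulus t ^ e.
have B1 : 1 <= B by rewrite -[1]mulr1; apply: ler_pM.
have pB : modulus (phi t) <= K3 * modulus t ^ e by [].
have dK' : delta <= K' * modulus t ^ e.
  by rewrite /delta ler_wpM2l ?(ltW K'0) // ler_weXz2l.
have le x y (D1 D2 : R) : modulus x <= D1 * modulus t ^ e -> modulus (y - x) <= delta ->
    D1 + K' <= BK -> modulus x <= B /\ modulus y <= B.
  move=> hx hy hD; have te0 : 0 <= modulus t ^ e by exact: exprz_ge0.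
  have hB := ler_wpM2r te0 hD; rewrite mulrDl in hB.
  have K't : 0 <= K' * modulus t ^ e by rewrite mulr_ge0 // ltW.
  have := modulusD (y - x) x; rewrite subrK /B => hxy; split; lra.
have [b1 b1'] := le _ _ _ 0 ht3 pd ltac:(rewrite /BK; lra).
have [b2 b2'] := le _ _ _ 0 ht4 qd ltac:(rewrite /BK; lra).
have d01 : 0 <= delta <= 1 by rewrite d0.
have [_ _ _ _ fin] := tay _ _ _ _ _ _ B1 d01 b1 b2 b1' b2' pd qd.
apply: le_trans fin _.
have -> : K * B ^+ M * delta ^+ 2 = K * BK ^+ M * K' ^+ 2 *
    modulus t ^ (e * M%:Z + 2 * (e - N%:Z)).
  have -> : modulus t ^ (e * M%:Z + 2 * (e - N%:Z)) =
      (modulus t ^ e) ^+ M * (modulus t ^ (e - N%:Z)) ^+ 2.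
    by rewrite 2!exprnP 2!exprz_exp -expfzDr ?gt_eqF // [2 * _]mulrC.
  by rewrite /B /delta !exprMn; ring.
have te : modulus t ^ (e * M%:Z + 2 * (e - N%:Z)) <= modulus t ^ (q - N%:Z).
  by rewrite ler_weXz2l.
apply: (@le_trans _ _ (K * BK ^+ M * K' ^+ 2 * modulus t ^ (q - N%:Z))).
  by rewrite ler_wpM2l // !mulr_ge0 ?exprn_ge0 // ltW // (lt_le_trans _ BK1).
by rewrite ler_wpM2r ?exprz_ge0 // lerDl.
Qed.

Lemma near_infty_invX (r : R) (N : nat) : 0 < r -> (0 < N)%N ->
  near_infty (fun t : C => modulus (t ^- N) <= r).
Proof.
move=> r0; case: N => // N _.
apply: filterS2 (near_infty_inv r0) (near_infty_gt 1) => t tr t1.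
apply: le_trans tr; rewrite -exprVn exprS modulusM ler_piMr // modulusX.
by rewrite exprn_ile1 // modulusV invf_le1 ?(lt_trans _ t1) // ltW.
Qed.

(* The chain rule t (f o Phi)' = f_x t phi' + f_y t psi', read off from
   increments along t * (1 + t^-N) for large N. *)
Lemma mdeg_comp2_le f phi psi e p k : meromorphic_infty phi -> meromorphic_infty psi ->
  growth_le e phi -> growth_le e psi -> 0 <= e ->
  growth_le p (comp2 (derivx f) phi psi) -> growth_le p (comp2 f^`() phi psi) ->
  mdeg (comp2 f phi psi) = k%:~R%:E -> k != 0 -> k <= p + e.
Proof.
move=> mphi mpsi Ophi Opsi e0 [G1 G10 hG1] [G2 G20 hG2] hk k0.
have mh := meromorphic_comp2 f mphi mpsi.
have [A A0 [r r0 hA]] := mdeg_diff_ge mh hk k0.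
have [N0 HN0] := chain_rule_diff f (p + e) mphi mpsi Ophi Opsi e0.
pose N := maxn 1 N0; have N1 : (0 < N)%N by rewrite leq_maxl.
have [K K0 hK] := HN0 N (leq_maxr _ _).
have [K1 K10 h1] := growth_le_diff mphi Ophi.
have [K2 K20 h2] := growth_le_diff mpsi Opsi.
have i2 : 0 < 2^-1 :> R by rewrite invr_gt0.
have sm1 := near_infty_invX r0 N1; have sm2 := near_infty_invX i2 N1.
suff : k - N%:Z <= p + e - N%:Z by rewrite lerD2r.
apply: (near_pow_le (K := G1 * K1 + G2 * K2 + K) A0).
apply: filterS2 (filterI (filterI hG1 hG2) (filterI h1 h2))
  (filterI (filterI hA hK) (filterI (filterI sm1 sm2) (near_infty_neq0 R))).
move=> t [[g1 g2] [l1 l2]] [[a1 a2] [[s1 s2] t0]].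
have {}a1 := a1 _ s1; have {}l1 := l1 _ s2; have {}l2 := l2 _ s2.
cbv zeta in a2; set s := t * (1 + t ^- N) in a1 a2 l1 l2.
have tn : modulus t != 0 by rewrite modulus_eq0.
have mw : modulus (t ^- N) = modulus t ^ (- N%:Z) by rewrite exprnN modulusXz.
rewrite mw in a1 l1 l2.
have -> : A * modulus t ^ (k - N%:Z) = A * modulus t ^ (- N%:Z) * modulus t ^ k.
  by rewrite expfzDr //; ring.
apply: le_trans a1 _; move: a2; set H := _ - comp2 f phi psi t.
set G := _ + _ * (psi s - psi t) => a2.
rewrite -(subrK G H); apply: le_trans (modulusD _ _) _.
have hG : modulus G <= (G1 * K1 + G2 * K2) * modulus t ^ (p + e - N%:Z).
  apply: le_trans (modulusD _ _) _; rewrite !modulusM.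
  have E i j : i * modulus t ^ p * (j * modulus t ^ (- N%:Z) * modulus t ^ e) =
      i * j * modulus t ^ (p + e - N%:Z) by rewrite !expfzDr //; ring.
  have e1 := ler_pM (modulus_ge0 _) (modulus_ge0 _) g1 l1; rewrite E in e1.
  have e2 := ler_pM (modulus_ge0 _) (modulus_ge0 _) g2 l2; rewrite E in e2.
  by rewrite mulrDl; exact: lerD.
by rewrite mulrDl addrC; exact: lerD.
Qed.

(** Where f_y vanishes along the curve the chain rule reduces to t (f o Phi)' = f_x t phi', and t
    phi' has exact degree d, which can be divided out. *)
Lemma growth_le_derivx f phi psi e q d : meromorphic_infty phi -> meromorphic_infty psi ->
  growth_le e phi -> growth_le e psi -> 0 <= e ->
  mdeg phi = d%:~R%:E -> d != 0 ->
  near_infty (fun t => comp2 f^`() phi psi t = 0) -> growth_le q (comp2 f phi psi) ->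
  growth_le (q - d) (comp2 (derivx f) phi psi).
Proof.
move=> mphi mpsi Ophi Opsi e0 hd d0 fy0 Oq.
have mh := meromorphic_comp2 f mphi mpsi.
have [A A0 [r r0 hA]] := mdeg_diff_ge mphi hd d0.
have [N0 HN0] := chain_rule_diff f q mphi mpsi Ophi Opsi e0.
pose N := maxn 1 N0; have N1 : (0 < N)%N by rewrite leq_maxl.
have [K K0 hK] := HN0 N (leq_maxr _ _).
have [K1 K10 h1] := growth_le_diff mh Oq.
have i2 : 0 < 2^-1 :> R by rewrite invr_gt0.
have sm1 := near_infty_invX r0 N1; have sm2 := near_infty_invX i2 N1.
exists ((K1 + K) / A); first by rewrite divr_gt0 // addr_gt0.
apply: filterS2 (filterI fy0 h1)
  (filterI (filterI hA hK) (filterI (filterI sm1 sm2) (near_infty_neq0 R))).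
move=> t [g l1] [[a1 a2] [[s1 s2] t0]].
have {}a1 := a1 _ s1; have {}l1 := l1 _ s2.
cbv zeta in a2; set s := t * (1 + t ^- N) in a1 a2 l1.
have tn : modulus t != 0 by rewrite modulus_eq0.
have tp : 0 < modulus t by rewrite modulus_gt0.
have mw : modulus (t ^- N) = modulus t ^ (- N%:Z) by rewrite exprnN modulusXz.
rewrite mw in a1 l1; rewrite g mul0r addr0 in a2.
move: a2 l1; set H := _ - comp2 f phi psi t; set G := comp2 _ _ _ t * _ => a2 l1.
have hG : modulus G <= (K1 + K) * modulus t ^ (q - N%:Z).
  rewrite -(subKr H G); apply: le_trans (modulusBD _ _) _.
  rewrite mulrDl; apply: lerD a2.
  by rewrite (_ : K1 * _ = K1 * modulus t ^ (- N%:Z) * modulus t ^ q) // expfzDr //; ring.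
have P0 : 0 < A * modulus t ^ (- N%:Z) * modulus t ^ d by rewrite !mulr_gt0 ?exprz_gt0.
rewrite -(ler_pM2r P0); apply: le_trans (_ : _ <= modulus G) _.
  by rewrite /G modulusM ler_wpM2l.
apply: le_trans hG _; rewrite le_eqVlt; apply/orP; left; apply/eqP.
have -> : q - N%:Z = (q - d) + (- N%:Z) + d by ring.
by rewrite !(expfzDr _ _ tn); field; rewrite lt0r_neq0.
Qed.

End Euler.

(** * Polynomials in one variable: values near a root, critical points near two roots, dominance of
    the monic term *)

Section Polynomials.
Variable R : realType.
Local Notation C := R[i].
Implicit Types (x y z : C) (p q : {poly C}).

(** This bounds the logarithmic derivative, the sum of the 1 / (y - b_j), with denominators cleared
    so that no division occurs. *)
Lemma deriv_prod_XsubC_bound (I : Type) (s : seq I) (P : pred I) (b : I -> C) y (nu : R) :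
  0 <= nu -> (forall j, P j -> nu <= modulus (y - b j)) ->
  modulus ((\prod_(j <- s | P j) ('X - (b j)%:P))^`().[y]) * nu <=
    (size s)%:R * modulus (\prod_(j <- s | P j) ('X - (b j)%:P)).[y].
Proof.
move=> nu0 hb; elim: s => [|i s IH].
  by rewrite big_nil derivC horner0 modulus0 mul0r mul0r.
rewrite big_cons; case: ifP => [Pi|_]; last first.
  by apply: le_trans IH _; rewrite ler_wpM2r // ler_nat.
set q := \prod_(j <- s | P j) _ in IH *.
rewrite derivM derivXsubC mul1r hornerD !hornerM !hornerXsubC.
apply: le_trans (ler_wpM2r nu0 (modulusD _ _)) _.
rewrite mulrDl !modulusM /= -addn1 natrD mulrDl mul1r addrC.
apply: lerD; last by rewrite mulrC ler_wpM2r ?hb.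
by rewrite -[leLHS]mulrA [leRHS]mulrCA ler_wpM2l.
Qed.

(** Take b_i nearest to y: then |y - b_j| >= |b_i - b_j| / 2 for all j, so the product q of the
    other factors satisfies |q(y)| >= Q. Either y - b_i is large enough for the first alternative,
    or q(y) dominates in the derivative q + (y - b_i) q'. *)
Lemma prod_XsubC_dichotomy n (b : 'I_n.+1 -> C) y : exists i, forall mu : R, 0 < mu ->
  (forall j, j != i -> mu <= modulus (b i - b j)) ->
  let Q := \prod_(j < n.+1 | j != i) (modulus (b i - b j) / 2) in
  mu / (4 * n.+1%:R) * Q <= modulus (\prod_j (y - b j)) \/
  Q / 2 <= modulus ((\prod_j ('X - (b j)%:P))^`().[y]).
Proof.
have [i _ imin] := @Order.TotalTheory.arg_minP _ R _ ord0 xpredT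
  (fun i => modulus (y - b i)) isT.
exists i => mu mu0 hmu Q; set N := n.+1%:R : R; have N0 : 0 < N by rewrite ltr0n.
have half j : modulus (b i - b j) / 2 <= modulus (y - b j).
  have := modulusBD (y - b j) (y - b i); rewrite (_ : _ - _ = b i - b j); last by ring.
  by have := imin j isT; lra.
set q := \prod_(j < n.+1 | j != i) ('X - (b j)%:P).
have qy : q.[y] = \prod_(j < n.+1 | j != i) (y - b j).
  by rewrite /q horner_prod; apply: eq_bigr => j _; rewrite hornerXsubC.
have Qq : Q <= modulus q.[y].
  rewrite qy modulus_prod; apply: ler_prod => j _.
  by rewrite half andbT divr_ge0.
rewrite (bigD1 i) //= -qy modulusM.
rewrite [\prod_j ('X - _)](bigD1 i) //= -/q derivM derivXsubC mul1r hornerD hornerM hornerXsubC.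
have Q0 : 0 <= Q by apply: prodr_ge0 => j _; rewrite divr_ge0.
(* With |q'(y)| mu / 2 <= N |q(y)|, the threshold mu / (4 N) makes |(y - b_i) q'(y)| at most |q(y)|
   / 2. *)
have [h|h] := leP (mu / (4 * N)) (modulus (y - b i)).
  by left; apply: ler_pM => //; rewrite divr_ge0 ?mulr_ge0 // ltW.
right.
have := @deriv_prod_XsubC_bound _ (index_enum 'I_n.+1) (fun j => j != i) b y (mu / 2).
rewrite -/q => /(_ _ _)/wrap[]; first by rewrite divr_ge0 // ltW.
  by move=> j ji; apply: le_trans (half j); rewrite ler_pM2r ?hmu.
rewrite -[index_enum _]enumT size_enum_ord -/N => hq.
have hq' : modulus ((y - b i) * q^`().[y]) <= modulus q.[y] / 2.
  rewrite modulusM; apply: le_trans (ler_wpM2r (modulus_ge0 _) (ltW h)) _.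
  rewrite (_ : mu / (4 * N) * _ = modulus q^`().[y] * (mu / 2) / (2 * N)); last first.
    by field; rewrite lt0r_neq0.
  rewrite ler_pdivrMr ?mulr_gt0 //; apply: le_trans hq _.
  by rewrite le_eqVlt; apply/orP; left; apply/eqP; field.
have := modulusBD (q.[y] + (y - b i) * q^`().[y]) ((y - b i) * q^`().[y]).
by rewrite addrK; lra.
Qed.

(** The sum of the moduli of the coefficients is submultiplicative, so the product is majorised by
    (1 + delta X)^m evaluated at 1. *)
Lemma coef_prod_1DX_bound (s : seq C) (delta : R) N : 0 <= delta ->
  (forall u, u \in s -> modulus u <= delta) ->
  \sum_(k < N) modulus (\prod_(u <- s) (1 + u *: 'X) - 1 : {poly C})`_k <=
    (1 + delta) ^+ size s - 1.
Proof.
move=> d0; elim: s => [|u s IH] hs.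
  by rewrite big_nil subrr expr0 subrr big1 // => k _; rewrite coef0 modulus0.
have {}IH := IH (fun v vs => hs v (mem_behead (s := u :: s) vs)).
have us : modulus u <= delta by apply: hs; rewrite mem_head.
rewrite big_cons; set E := \prod_(v <- s) _ in IH *.
have -> : (1 + u *: 'X) * E - 1 = (E - 1) + u *: (E * 'X).
  by rewrite mulrDl mul1r -scalerAl mulrC addrAC.
have ubE : \sum_(k < N) modulus (E * 'X)`_k <= (1 + delta) ^+ size s.
  case: N IH => [|N] IH; first by rewrite big_ord0 exprn_ge0 // addr_ge0.
  rewrite big_ord_recl coefMX /= modulus0 add0r.
  under eq_bigr do rewrite coefMX /=.
  have : \sum_(k < N) modulus E`_k <= 1 + \sum_(k < N.+1) modulus (E - 1)`_k.
    apply: (@le_trans _ _ (\sum_(k < N.+1) (modulus ((1 : {poly C})`_k) + modulus (E - 1)`_k))).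
      rewrite [leRHS]big_ord_recr /= -[leLHS]addr0 lerD ?addr_ge0 //.
      apply: ler_sum => k _; rewrite -{1}(subrK 1 E) coefD addrC.
      exact: modulusD.
    rewrite big_split /= lerD2r big_ord_recl coefC /= modulus1 big1 ?addr0 // => k _.
    by rewrite coefC /= modulus0.
  by move=> /le_trans; apply; rewrite -lerBrDl.
apply: (@le_trans _ _ (\sum_(k < N) (modulus (E - 1)`_k + delta * modulus (E * 'X)`_k))).
  apply: ler_sum => k _; rewrite coefD coefZ; apply: le_trans (modulusD _ _) _.
  by rewrite modulusM lerD2l ler_wpM2r.
rewrite big_split /= -mulr_sumr exprS.
by have := ler_wpM2l d0 ubE; rewrite mulrDl mul1r; lra.
Qed.

(** By convexity (1 + delta)^m lies below its chord over [0, 1]. *)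
Lemma expr1D_small (delta : R) m : 0 <= delta <= 1 ->
  (1 + delta) ^+ m - 1 <= (2 ^+ m - 1) * delta.
Proof.
move=> /andP[d0 d1]; elim: m => [|m IH]; first by rewrite !expr0 !subrr mul0r.
have h : (1 + delta) ^+ m <= 2 ^+ m by rewrite lerXn2r ?nnegrE ?addr_ge0 //; lra.
rewrite !exprS mulrDl mul1r.
have := ler_wpM2l d0 h; lra.
Qed.

(* With P' = c prod (X - g_j) and E = prod (1 + u_j X) its renormalisation on
   the segment from b to b', P(b') - P(b) is a nonzero multiple of
   sum_k E_k / (k + 1), whose first term dominates if all u_j are small. *)
Lemma critical_point_near_two_roots m (P : {poly C}) (c : C) (g : 'I_m -> C) (b b' : C) :
  c != 0 -> P^`() = c *: \prod_j ('X - (g j)%:P) -> P.[b] = P.[b'] -> b != b' ->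
  exists j, modulus (g j - b) <= 2 ^+ m * modulus (b' - b).
Proof.
move=> c0 hP hb bb'; apply/not_existsP => far.
have {far} far j : 2 ^+ m * modulus (b' - b) < modulus (b - g j).
  by rewrite ltNge modulusB; apply/negP => /far.
set h := b' - b in far *.
have h0 : h != 0 by rewrite subr_eq0 eq_sym.
have hp : 0 < modulus h by rewrite modulus_gt0.
have bg j : b - g j != 0.
  by rewrite -modulus_gt0 (le_lt_trans _ (far j)) // mulr_ge0 ?exprn_ge0.
pose u j := h / (b - g j).
have hu j : modulus (u j) <= (2 ^+ m)^-1.
  rewrite modulusM modulusV ler_pdivrMr ?modulus_gt0 // mulrC.
  by rewrite ler_pdivlMr ?exprn_gt0 // mulrC ltW.
pose E := \prod_(v <- [seq u j | j <- enum 'I_m]) (1 + v *: 'X : {poly C}).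
pose c' := h * c * \prod_j (b - g j).
have c'0 : c' != 0 by rewrite !mulf_neq0 //; apply/prodf_neq0 => j _; exact: bg.
pose q := b%:P + h *: 'X : {poly C}; pose Q := P \Po q.
have hQ : Q^`() = c' *: E.
  rewrite /Q deriv_comp hP /q derivD derivC add0r derivZ derivX.
  rewrite comp_polyZ rmorph_prod /= /E big_map big_enum /=.
  rewrite (eq_bigr (fun j => (b - g j) *: (1 + u j *: 'X))) => [|j _]; last first.
    rewrite comp_polyB comp_polyX comp_polyC scalerDr scalerA.
    by rewrite /u mulrC divfK // alg_polyC polyCB addrAC.
  rewrite scaler_prod scalerA -scalerAl -scalerAr mulr1 scalerA.
  by congr (_ *: _); rewrite /c'; ring.
pose N := size Q.
(* Q(1) = Q(0) in terms of coefficients: the integral of Q' over [0, 1] vanishes. *)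
have hsum : \sum_(k < N) Q`_k.+1 = 0.
  have : Q.[1] - Q.[0] = 0.
    have q1 : q.[1] = b' by rewrite hornerD hornerC hornerZ hornerX /h; ring.
    have q0 : q.[0] = b by rewrite hornerD hornerC hornerZ hornerX /h; ring.
    by rewrite /Q !horner_comp q1 q0 hb subrr.
  rewrite (@horner_coef_wide _ N.+1 Q 1) ?leqnSn // horner_coef0 big_ord_recl.
  rewrite expr0 mulr1 addrAC subrr add0r => H; rewrite -[RHS]H.
  by apply: eq_bigr => k _; rewrite expr1n mulr1.
have hE k : Q`_k.+1 = c' * (E`_k / k.+1%:R).
  have := congr1 (fun p : {poly C} => p`_k) hQ; rewrite coef_deriv coefZ mulrA => <-.
  by rewrite -[_ *+ _]mulr_natr mulfK // pnatr_eq0.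
have {hsum} hsum : \sum_(k < N) E`_k / k.+1%:R = 0.
  apply: (mulfI c'0); rewrite mulr0 mulr_sumr -[RHS]hsum.
  by apply: eq_bigr => k _; rewrite hE.
have E0 : E`_0 = 1.
  rewrite -horner_coef0 /E horner_prod big1_seq // => v _.
  by rewrite !hornerE.
have N0 : (0 < N)%N.
  rewrite lt0n size_poly_eq0; apply: contra_neq c'0 => Q0.
  by have := hE 0%N; rewrite Q0 coef0 divr1 E0 mulr1.
pose delta := (2 ^+ m)^-1 : R.
have d01 : 0 <= delta <= 1.
  by rewrite invr_ge0 exprn_ge0 //= invf_le1 ?exprn_gt0 // exprn_ege1 // ler1n.
have hEs : \sum_(k < N) modulus (E - 1)`_k <= (1 + delta) ^+ m - 1.
  have := @coef_prod_1DX_bound [seq u j | j <- enum 'I_m] delta N.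
  rewrite size_map size_enum_ord; apply; first by case/andP: d01.
  by move=> _ /mapP[j _ ->]; exact: hu.
(* Origin of the constant 2^m: |u_j| <= 2^-m gives (1 + 2^-m)^m - 1 <= (2^m - 1) 2^-m < 1, so the
   rest of E cannot cancel E_0 = 1. *)
have lt1 : \sum_(k < N) modulus (E - 1)`_k < 1.
  apply: le_lt_trans hEs _; apply: le_lt_trans (expr1D_small m d01) _.
  by rewrite ltr_pdivrMr ?exprn_gt0 // mul1r ltrBlDr ltrDl.
have key : \sum_(k < N) (E - 1)`_k / k.+1%:R = -1.
  under eq_bigr do rewrite coefB mulrBl.
  rewrite sumrB hsum sub0r; congr (- _); rewrite (bigD1 (Ordinal N0)) //= coefC /=.
  rewrite divr1 big1 ?addr0 // => k kN.
  by rewrite coefC (_ : (_ == _) = false) ?mul0r //; exact/negP/negP.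
have : modulus (\sum_(k < N) (E - 1)`_k / k.+1%:R) = 1.
  by rewrite key modulusN modulus1.
apply/eqP; rewrite lt_eqF //; apply: le_lt_trans lt1.
apply: le_trans (modulus_sum _ _ _) _; apply: ler_sum => k _.
rewrite modulusM ler_piMr // modulusV modulus_nat invf_le1 ?ltr0n //.
by rewrite ler1n.
Qed.

(** Adds the case b_i = b_l: a double root is itself a root of the derivative, at distance 0. *)
Lemma critical_point_near_roots n m (b : 'I_n -> C) (c : C) (g : 'I_m -> C) (i l : 'I_n) :
  i != l -> c != 0 ->
  (\prod_j ('X - (b j)%:P))^`() = c *: \prod_j ('X - (g j)%:P) ->
  exists j, modulus (g j - b i) <= 2 ^+ m * modulus (b l - b i).
Proof.
move=> il c0 hP.
have li : l != i by rewrite eq_sym.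
have root k : (\prod_j ('X - (b j)%:P)).[b k] = 0.
  by rewrite horner_prod (bigD1 k) //= hornerXsubC subrr mul0r.
have [bil|bil] := eqVneq (b i) (b l); last first.
  by apply: critical_point_near_two_roots hP _ bil => //; rewrite !root.
have /eqP : (\prod_j ('X - (b j)%:P))^`().[b i] = 0.
  rewrite (bigD1 i) //= (bigD1 l) //= derivM derivXsubC mul1r hornerD !hornerM.
  by rewrite !hornerXsubC bil subrr !mul0r add0r.
rewrite hP hornerZ mulf_eq0 (negPf c0) /= horner_prod prodf_seq_eq0 => /hasP[j _].
rewrite /= hornerXsubC subr_eq0 => /eqP big; exists j.
by rewrite big subrr modulus0 mulr_ge0 ?exprn_ge0.
Qed.

Lemma poly_ext_horner p q : (forall y, p.[y] = q.[y]) -> p = q.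
Proof.
move=> pq; apply/eqP; rewrite -subr_eq0; apply/negPn/negP => pq0.
pose s := [seq (k%:R : C) | k <- iota 0 (size (p - q))].
have us : uniq s by rewrite map_inj_uniq ?iota_uniq //; exact: mulrIn.
have rs : all (root (p - q)) s.
  by apply/allP => y _; rewrite rootE hornerD hornerN pq subrr.
by have := max_poly_roots pq0 rs us; rewrite size_map size_iota ltnn.
Qed.

Lemma eval2E (f : {poly {poly C}}) x y :
  eval2 f x y = (map_poly (horner_eval x) f).[y].
Proof.
by rewrite -{2}(hornerC y x) -/(horner_eval x y%:P) horner_map.
Qed.

Lemma eval2_deriv (f : {poly {poly C}}) x y :
  eval2 f^`() x y = (map_poly (horner_eval x) f)^`().[y].
Proof. by rewrite eval2E deriv_map. Qed.

Lemma size_horner_bound p i : (size p <= i.+1)%N -> exists2 A : R, 0 <= A &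
  forall (B : R) x, 1 <= B -> modulus x <= B -> modulus p.[x] <= A * B ^+ i.
Proof.
move=> pi; exists (\sum_(k < i.+1) modulus p`_k) => [|B x B1 xB].
  by apply: sumr_ge0.
rewrite (horner_coef_wide x pi); apply: le_trans (modulus_sum _ _ _) _.
rewrite mulr_suml; apply: ler_sum => k _; rewrite modulusM modulusX ler_wpM2l //.
apply: le_trans (_ : B ^+ k <= _).
  by apply: lerXn2r => //; rewrite nnegrE //; exact: le_trans ler01 B1.
by rewrite ler_weXn2l // -ltnS.
Qed.

Lemma monic_dominates n (a : nat -> {poly C}) (lambda : C) : (0 < n)%N ->
  (forall i, (1 <= i <= n)%N -> (size (a i) <= i.+1)%N) ->
  exists2 K : R, 1 <= K & forall x y, K <= modulus y -> K * modulus x <= modulus y ->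
    2^-1 * modulus y ^+ n <=
    modulus (eval2 ('X^n + \sum_(1 <= i < n.+1) (a i)%:P * 'X^(n - i)) x y - lambda).
Proof.
move=> n0 ha.
have /choice[A hA] (i : nat) : exists A : R, 0 <= A /\ ((1 <= i <= n)%N ->
    forall (B : R) x, 1 <= B -> modulus x <= B -> modulus (a i).[x] <= A * B ^+ i).
  have [hi|hi] := boolP (1 <= i <= n)%N; last by exists 0.
  by have [A A0 hA] := size_horner_bound (ha i hi); exists A.
pose S := \sum_(1 <= i < n.+1) A i.
have S0 : 0 <= S by apply: sumr_ge0 => i _; case: (hA i).
(* For |x| <= |y| / K each a_i(x) y^(n-i) is at most A_i |y|^n / K, and |lambda| <= |lambda| |y|^n /
   K; this K makes the total at most |y|^n / 2. *)
pose K := 2 * (S + modulus lambda) + 1.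
have K1 : 1 <= K by rewrite /K lerDr mulr_ge0 ?addr_ge0.
have K0 : 0 < K by rewrite (lt_le_trans _ K1).
exists K => // x y Ky Kxy; set Y := modulus y in Ky Kxy *.
have B1 : 1 <= Y / K by rewrite ler_pdivlMr ?mul1r.
have xB : modulus x <= Y / K by rewrite ler_pdivlMr // mulrC.
have Y1 : 1 <= Y by apply: le_trans Ky.
have term i : (1 <= i <= n)%N -> modulus ((a i).[x] * y ^+ (n - i)) <= A i / K * Y ^+ n.
  move=> hi; have [A0 /(_ hi) /(_ _ _ B1 xB) hAi] := hA i.
  rewrite modulusM modulusX -/Y; apply: le_trans (ler_wpM2r _ hAi) _.
    by rewrite exprn_ge0 // (le_trans _ Y1).
  case/andP: hi => i1 iN; rewrite -{2}(subnKC iN) exprD !mulrA ler_wpM2r //.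
    by rewrite exprn_ge0 // (le_trans _ Y1).
  rewrite exprMn mulrA mulrAC ler_wpM2r ?exprn_ge0 ?(le_trans _ Y1) // ler_wpM2l //.
  by rewrite exprVn lef_pV2 ?posrE ?exprn_gt0 // -{1}(expr1 K) ler_weXn2l.
have Yn : Y <= Y ^+ n by rewrite -{1}(expr1 Y) ler_weXn2l.
have lam : modulus lambda <= modulus lambda / K * Y ^+ n.
  rewrite -mulrA ler_peMr // ler_pdivlMl // mulr1; exact: le_trans Ky Yn.
rewrite /eval2 hornerD hornerXn horner_sum hornerD -polyC_exp hornerC horner_sum.
set T := \sum_(_ <= _ < _) _.
have hT : modulus T <= S / K * Y ^+ n.
  apply: le_trans (modulus_sum _ _ _) _; rewrite /S !mulr_suml.
  rewrite !big_nat; apply: ler_sum => i hi.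
  rewrite hornerM hornerC hornerXn -polyC_exp hornerM hornerC.
  by apply: term; rewrite -ltnS.
have tri : Y ^+ n <= modulus (y ^+ n + T - lambda) + modulus T + modulus lambda.
  rewrite -modulusX -{1}[y ^+ n](addrK (T - lambda)) addrA -addrA.
  apply: le_trans (modulusBD _ _) _; rewrite -addrA lerD2l; exact: modulusBD.
have : (S + modulus lambda) / K <= 2^-1 by rewrite ler_pdivrMr // /K; lra.
rewrite mulrDl => h; have := ler_wpM2r (exprn_ge0 n (le_trans ler01 Y1)) h.
rewrite mulrDl; lra.
Qed.

End Polynomials.

(** * Lower bounds for f - lambda and f_y in terms of the distances between roots *)

Section RootSeparation.
Variable R : realType.
Local Notation C := R[i].
Implicit Types (phi psi : C -> C) (f : {poly {poly C}}) (t x y : C).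

(** The inverse of 1 + sum of the 1 / A_i is at most 1 and at most every A_i. *)
Lemma uniform_lower_bound (I : finType) (P : pred I) (u v : I -> C -> R) :
  (forall i t, 0 <= v i t) ->
  (forall i, P i -> exists2 A : R, 0 < A & near_infty (fun t => A * v i t <= u i t)) ->
  exists2 A : R, 0 < A <= 1 &
    near_infty (fun t => forall i, P i -> A * v i t <= u i t).
Proof.
move=> v0 h.
have /choice[A hA] i : exists A : R, 0 < A /\
    near_infty (fun t => P i -> A * v i t <= u i t).
  case: (boolP (P i)) => [/h[A A0 hA]|_]; last by exists 1; split=> //; apply: filterE.
  by exists A; split=> //; apply: filterS hA => t.
have S0 : 0 <= \sum_i (A i)^-1 by apply: sumr_ge0 => i _; rewrite invr_ge0 ltW ?(hA i).1.
exists (1 + \sum_i (A i)^-1)^-1.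
  by rewrite invr_gt0 ltr_wpDr // invf_le1 ?lerDl // ltr_wpDr.
have := @filter_forall _ _ (fun i t => P i -> A i * v i t <= u i t) _
  (@filter_filter _ _ (near_infty_proper R)) (fun i => (hA i).2).
apply: filterS => t ht i Pi; apply: le_trans (ht i Pi); rewrite ler_wpM2r //.
rewrite -[leRHS]invrK lef_pV2 ?posrE ?invr_gt0 ?(hA i).1 ?ltr_wpDr //.
rewrite (bigD1 i) //= addrCA lerDl addr_ge0 //.
by apply: sumr_ge0 => j _; rewrite invr_ge0 ltW ?(hA j).1.
Qed.

Lemma near_eval2_roots f (lambda : C) n D (beta : 'I_n -> C -> C) :
  near_infty (fun t => forall y, eval2 f (t ^+ D) y - lambda = \prod_(i < n) (y - beta i t)) ->
  near_infty (fun t => forall y,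
    eval2 f^`() (t ^+ D) y = (\prod_(i < n) ('X - (beta i t)%:P))^`().[y]).
Proof.
apply: filterS => t ht y.
have E : map_poly (horner_eval (t ^+ D)) f - lambda%:P = \prod_(i < n) ('X - (beta i t)%:P).
  apply: poly_ext_horner => z; rewrite hornerD hornerN hornerC -eval2E ht horner_prod.
  by apply: eq_bigr => i _; rewrite hornerXsubC.
by rewrite eval2_deriv -E derivB derivC subr0.
Qed.

(** M and M' are only lower bounds for the exponents, so the lemma serves both with M = M' = 0 and
    with M' = M - D. The nearest root may change with t and y, which is why the hypothesis is
    uniform in i. *)
Lemma root_separation f (lambda : C) n D (beta : 'I_n.+1 -> C -> C)
    (d : 'I_n.+1 -> 'I_n.+1 -> int) (M M' : int) :
  near_infty (fun t => forall y,
    eval2 f (t ^+ D) y - lambda = \prod_(i < n.+1) (y - beta i t)) ->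
  (forall i j, j != i -> growth_ge (d i j) (fun t => beta i t - beta j t)) ->
  (forall i, exists m, [/\ forall j, j != i -> m <= d i j,
     M <= \sum_(j < n.+1 | j != i) d i j + m & M' <= \sum_(j < n.+1 | j != i) d i j]) ->
  exists2 c : R, 0 < c & near_infty (fun t => forall y,
    c * modulus t ^ M <= modulus (eval2 f (t ^+ D) y - lambda) \/
    c * modulus t ^ M' <= modulus (eval2 f^`() (t ^+ D) y)).
Proof.
move=> hf hd hM.
have [A /andP[A0 A1] hA] := @uniform_lower_bound ('I_n.+1 * 'I_n.+1)%type (fun p => p.2 != p.1)
  (fun p t => modulus (beta p.1 t - beta p.2 t)) (fun p t => modulus t ^ d p.1 p.2)
  (fun p t => exprz_ge0 _ (modulus_ge0 t)) (fun p => hd p.1 p.2).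
have hfy := near_eval2_roots hf.
set N := n.+1%:R : R; have N0 : 0 < N by rewrite ltr0n.
have N1 : 1 <= N by rewrite ler1n.
(* As A <= 1, this c is also at most (A / 2)^n / 2, the constant of the second alternative. *)
pose c := A / (4 * N) * (A / 2) ^+ n.
have A2 : 0 < A / 2 by rewrite divr_gt0.
have AN : A / (4 * N) <= 2^-1 by rewrite ler_pdivrMr ?mulr_gt0 //; lra.
exists c; first by rewrite mulr_gt0 ?exprn_gt0 // divr_gt0 // mulr_gt0.
apply: filterS3 (filterI hA (near_infty_gt 1)) hf hfy => t [hAt t1] ft fyt y.
have tp : 0 < modulus t by rewrite (lt_trans _ t1).
have [i hi] := prod_XsubC_dichotomy (fun j => beta j t) y.
have [m [hm hMi hM'i]] := hM i.
have mu0 : 0 < A * modulus t ^ m by rewrite mulr_gt0 // exprz_gt0.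
have muj j : j != i -> A * modulus t ^ m <= modulus (beta i t - beta j t).
  move=> ji; apply: le_trans (hAt (i, j) ji).
  by rewrite ler_wpM2l ?(ltW A0) // ler_weXz2l ?(ltW t1) ?hm.
have {hi} := hi _ mu0 muj; cbv zeta; set Q := \prod_(j < _ | _) _.
set S := \sum_(j < n.+1 | j != i) d i j in hMi hM'i.
have hQ : (A / 2) ^+ n * modulus t ^ S <= Q.
  have -> : (A / 2) ^+ n * modulus t ^ S =
      \prod_(j < n.+1 | j != i) (A / 2 * modulus t ^ d i j).
    rewrite big_split /= prodr_const cardC1 card_ord; congr (_ * _).
    rewrite /S; elim/big_rec2: _ => [|j x z _ <-]; first by rewrite expr0z.
    by rewrite expfzDr // gt_eqF.
  apply: ler_prod => j ji; rewrite mulr_ge0 ?exprz_ge0 ?(ltW A2) //=.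
  by have := hAt (i, j) ji; rewrite /=; lra.
rewrite ft fyt => -[h|h]; [left|right]; apply: le_trans h.
- have -> : A * modulus t ^ m / (4 * N) = A / (4 * N) * modulus t ^ m by ring.
  rewrite /c -!mulrA ler_wpM2l ?(ltW A0) // ler_wpM2l ?invr_ge0 ?mulr_ge0 ?(ltW N0) //.
  apply: le_trans (ler_wpM2l (exprz_ge0 _ (modulus_ge0 t)) hQ).
  rewrite mulrCA ler_wpM2l ?exprn_ge0 ?(ltW A2) // -expfzDr ?gt_eqF //.
  by rewrite ler_weXz2l ?(ltW t1) // addrC.
- have c2 : c <= 2^-1 * (A / 2) ^+ n by rewrite /c ler_wpM2r ?exprn_ge0 ?(ltW A2).
  have c0 : 0 <= c.
    by rewrite /c mulr_ge0 ?exprn_ge0 ?(ltW A2) ?divr_ge0 ?(ltW A0) ?mulr_ge0 ?(ltW N0).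
  have tM : modulus t ^ M' <= modulus t ^ S by rewrite ler_weXz2l ?(ltW t1).
  apply: le_trans (ler_pM c0 (exprz_ge0 _ (modulus_ge0 t)) c2 tM) _; lra.
Qed.

(** The D-th root is a pointwise choice without any continuity; only its modulus, which tends to
    infinity, matters. *)
Lemma near_infty_root D (phi : C -> C) e (P : C -> Prop) : (0 < D)%N -> 0 < e ->
  growth_ge e phi -> near_infty P -> near_infty (fun t => P (D.-root (phi t))).
Proof.
move=> D0 e0 [A A0 hA] [r r0 hr].
apply: filterS2 hA (filterI (near_infty_gt 1) (near_infty_gt (r ^+ D / A))) => t ht [t1 tr].
apply: hr; rewrite -(ltr_pXn2r D0) ?nnegrE ?(ltW r0) // -modulusX rootCK //.
apply: lt_le_trans ht; move: tr; rewrite ltr_pdivrMr // mulrC => tr.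
apply: lt_le_trans tr _; rewrite ler_pM2l // -[leLHS]expr1z ler_weXz2l ?(ltW t1) //.
Qed.

(** For negative m the inequality is reversed, so the upper bound on phi is the one used. *)
Lemma growth_expz e m phi : growth_le e phi -> growth_ge e phi ->
  exists2 A : R, 0 < A & near_infty (fun t => A * modulus t ^ (e * m) <= modulus (phi t) ^ m).
Proof.
move=> [K K0 hK] [A A0 hA]; case: m => m.
  exists (A ^+ m); first exact: exprn_gt0.
  apply: filterS hA => t ht; rewrite -exprz_exp -!exprnP -exprMn.
  by rewrite lerXn2r ?nnegrE // mulr_ge0 ?exprz_ge0 ?(ltW A0).
exists (K ^+ m.+1)^-1; first by rewrite invr_gt0 exprn_gt0.
apply: filterS3 (near_infty_gt 0) hA hK => t t0 hAt ht.
rewrite NegzE -exprz_exp -!exprnN -invfM -exprMn.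
have p0 : 0 < modulus (phi t) by apply: lt_le_trans hAt; rewrite mulr_gt0 ?exprz_gt0.
rewrite lef_pV2 ?posrE ?exprn_gt0 ?mulr_gt0 ?exprz_gt0 //.
by rewrite lerXn2r ?nnegrE // mulr_ge0 ?exprz_ge0 ?(ltW K0).
Qed.

End RootSeparation.

(** * Consequences for the two exponents, in integer form *)

Section Bounds.
Variable R : realType.
Local Notation C := R[i].
Implicit Types (phi psi : C -> C) (f : {poly {poly C}}) (t x y : C).

Lemma derivx_subC f (lambda : C) : derivx (f - lambda%:P%:P) = derivx f.
Proof.
apply/polyP => i; rewrite /derivx !coef_map_id0 ?deriv0 // coefB derivB coefC.
by case: ifP => _; rewrite ?derivC ?deriv0 subr0.
Qed.

Lemma deriv_subC f (lambda : C) : (f - lambda%:P%:P)^`() = f^`().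
Proof. by rewrite derivB derivC subr0. Qed.

Lemma eval2_subC f (lambda : C) x y : eval2 (f - lambda%:P%:P) x y = eval2 f x y - lambda.
Proof. by rewrite /eval2 !hornerE. Qed.

Lemma mapnorm2_ge (F G : {poly {poly C}}) x y (c : R) :
  c <= modulus (eval2 F x y) \/ c <= modulus (eval2 G x y) ->
  c <= mapnorm [tuple F; G] x y.
Proof.
rewrite /mapnorm !big_ord_recl big_ord0 !(tnth_nth 0) /= => -[h|h]; rewrite !le_max h //.
by rewrite orbT.
Qed.

Lemma lojasiewicz_infty_ge0 f (lambda : C) n D (beta : 'I_n.+1 -> C -> C)
    (d : 'I_n.+1 -> 'I_n.+1 -> int) (K : R) :
  (0 < D)%N -> 1 <= K ->
  (forall x y, K <= modulus y -> K * modulus x <= modulus y ->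
    2^-1 <= modulus (eval2 f x y - lambda)) ->
  near_infty (fun t => forall y,
    eval2 f (t ^+ D) y - lambda = \prod_(i < n.+1) (y - beta i t)) ->
  (forall i j, j != i -> growth_ge (d i j) (fun t => beta i t - beta j t)) ->
  (forall i, exists m, [/\ forall j, j != i -> m <= d i j,
     0 <= \sum_(j < n.+1 | j != i) d i j + m & 0 <= \sum_(j < n.+1 | j != i) d i j]) ->
  (0 <= lojasiewicz_infty [tuple (f - lambda%:P%:P)%R; f^`()%R])%E.
Proof.
move=> D0 K1 hK hf hd hM; have [c c0 [r r0 hr]] := root_separation hf hd hM.
have K0 : 0 < K by rewrite (lt_le_trans _ K1).
have rD : 0 < r ^+ D by rewrite exprn_gt0.
(* The exponent nu = 0 is admissible. Where |x| <= r^D, a point beyond this B has |y| >= K and |y|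
   >= K r^D >= K |x|, so the monic term dominates. *)
apply: ereal_sup_ubound; exists 0 => //; exists (Num.min c 2^-1), (r ^+ D + K + K * r ^+ D).
split; first by rewrite lt_min c0 invr_gt0 /=.
  by rewrite !addr_gt0 // mulr_gt0.
have KrD : 0 <= K * r ^+ D by rewrite mulr_ge0 ?ltW.
move=> x y; rewrite powRr0 mulr1 => hB; apply: mapnorm2_ge; rewrite eval2_subC.
have [xr|xr] := ltP (r ^+ D) (modulus x).
  have := hr (D.-root x); rewrite -(ltr_pXn2r D0) ?nnegrE ?(ltW r0) // -modulusX rootCK //.
  move=> /(_ xr y); rewrite !expr0z !mulr1 => -[h|h]; [left|right];
  by apply: le_trans h; rewrite ge_min lexx.
left; apply: le_trans (hK x y _ _); first by rewrite ge_min lexx orbT.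
- by move: hB; rewrite lt_max => /orP[]; lra.
- apply: le_trans (ler_wpM2l (ltW K0) xr) _.
  by move: hB; rewrite lt_max => /orP[]; lra.
Qed.

(** This is p / e >= M / D - 1 without denominators. The separation estimate at t := phi(t)^(1/D) is
    raised to the power D, after which only integer powers of |phi(t)| remain. *)
Lemma lojasiewicz_at_int_ge f (lambda : C) n D (beta : 'I_n.+1 -> C -> C)
    (d : 'I_n.+1 -> 'I_n.+1 -> int) (M e p : int) phi psi :
  (0 < D)%N ->
  near_infty (fun t => forall y,
    eval2 f (t ^+ D) y - lambda = \prod_(i < n.+1) (y - beta i t)) ->
  (forall i j, j != i -> growth_ge (d i j) (fun t => beta i t - beta j t)) ->
  (forall i, exists m, [/\ forall j, j != i -> m <= d i j,
     M <= \sum_(j < n.+1 | j != i) d i j + m &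
     M - D%:Z <= \sum_(j < n.+1 | j != i) d i j]) ->
  meromorphic_infty phi -> meromorphic_infty psi -> 0 < e ->
  growth_le e phi -> growth_ge e phi -> growth_le e psi ->
  growth_le (-1) (comp2 (f - lambda%:P%:P) phi psi) ->
  growth_le p (comp2 (derivx f) phi psi) -> growth_le p (comp2 f^`() phi psi) ->
  e * M <= (p + e) * D%:Z.
Proof.
move=> D0 hf hd hM mphi mpsi e0 Ophi Omphi Opsi Oh Ofx Ofy.
have [c c0 hc] := root_separation hf hd hM.
rewrite leNgt; apply/negP => small.
have mh := meromorphic_comp2 (f - lambda%:P%:P) mphi mpsi.
set h := comp2 _ phi psi in Oh mh.
have hc' := near_infty_root D0 e0 Omphi hc.
have pw m t : (modulus (D.-root (phi t)) ^ m) ^+ D = modulus (phi t) ^ m.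
  by rewrite exprnP exprz_exp mulrC -exprz_exp -exprnP -modulusX rootCK.
have [A1 A10 hA1] := growth_expz M Ophi Omphi.
have [A2 A20 hA2] := growth_expz (M - D%:Z) Ophi Omphi.
have [K K0 hK] := Ofy.
have step t y (g : R) m : 0 <= g -> c * modulus (D.-root (phi t)) ^ m <= g ->
    c ^+ D * modulus (phi t) ^ m <= g ^+ D.
  move=> g0 hg; rewrite -pw -exprMn lerXn2r ?nnegrE //.
  by rewrite mulr_ge0 ?exprz_ge0 ?(ltW c0).
have cD : 0 < c ^+ D by rewrite exprn_gt0.
have KD : 0 < K ^+ D by rewrite exprn_gt0.
(* By integrality the assumed failure leaves one full power of |t| to spare, so for large t the
   alternative on f_y contradicts its growth bound and the one on h must hold. *)
have arith : p * D%:Z + 1 <= e * (M - D%:Z).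
  move: small; rewrite mulrDl mulrBr -lezD1; lia.
have Omh : exists2 B : R, 0 < B &
    near_infty (fun t => B * modulus t ^ (e * M) <= modulus (h t) ^+ D).
  exists (c ^+ D * A1); first exact: mulr_gt0.
  apply: filterS3 (filterI hA1 hA2) (filterI hK hc')
    (filterI (near_infty_gt 1) (near_infty_gt (K ^+ D / (c ^+ D * A2)))).
  move=> t [a1 a2] [k /(_ (psi t))] + [t1 tK].
  have tp : 0 < modulus t by rewrite (lt_trans _ t1).
  rewrite rootCK // => -[|] hct.
    have := step t 0 _ _ (modulus_ge0 _) hct; rewrite -eval2_subC => /(le_trans _); apply.
    by rewrite -mulrA ler_pM2l.
  have := step t 0 _ _ (modulus_ge0 _) hct.
  rewrite leNgt => /negP[].
  apply: le_lt_trans (_ : K ^+ D * modulus t ^ (p * D%:Z) < _).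
    rewrite -exprz_exp -exprnP -exprMn lerXn2r ?nnegrE //.
    by rewrite mulr_ge0 ?exprz_ge0 ?(ltW K0).
  apply: lt_le_trans (ler_wpM2l (ltW cD) a2).
  apply: lt_le_trans (_ : c ^+ D * (A2 * modulus t ^ (p * D%:Z + 1)) <= _); last first.
    by rewrite !ler_pM2l // ler_weXz2l // ltW.
  rewrite expfzDr ?gt_eqF // expr1z !mulrA mulrAC ltr_pM2r ?exprz_gt0 //.
  by move: tK; rewrite ltr_pdivrMr ?mulr_gt0 // mulrC.
case: Omh => B B0 hB.
case: (meromorphic_cases mh) => [[h0 _]|[k [a [L [ga hk]]]]].
  have : near_infty (fun t : C => B * modulus t ^ (e * M) <= 0).
    by apply: filterS2 h0 hB => t ->; rewrite modulus0 expr0n -[D]prednK.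
  exact: near_pow_le0.
have [[K' K'0 hK'] Omk] := germ_bounds ga.
have k0 : k <= -1 := growth_le_ge Oh Omk.
have eM : e * M <= k * D%:Z.
  apply: (near_pow_le (K := K' ^+ D) B0).
  apply: filterS2 hB hK' => t /le_trans hb hk'; apply: hb.
  rewrite -exprz_exp -exprnP -exprMn lerXn2r ?nnegrE //.
  by rewrite mulr_ge0 ?exprz_ge0 ?(ltW K'0).
(* The chain rule needs a nonzero degree: k <= -1 because h tends to 0. *)
have kp : k <= p + e.
  apply: mdeg_comp2_le mphi mpsi Ophi Opsi (ltW e0) _ _ hk _.
  - by rewrite derivx_subC.
  - by rewrite deriv_subC.
  - by rewrite lt_eqF // (le_lt_trans k0).
have := lt_le_trans small eM.
by rewrite ltNge ler_wpM2r.
Qed.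

Lemma mdeg_of_int phi : meromorphic_infty phi ->
  mdeg phi = -oo%E \/ exists m : int, mdeg phi = m%:~R%:E.
Proof.
move=> /meromorphic_cases[[_ ->]|[d [a [L [_ ->]]]]]; first by left.
by right; exists d.
Qed.

(** If deg phi were smaller than e, then deg psi = e and the curve would end up where |y| >= K and
    |y| >= K |x|. There |f - lambda| >= 1/2, against the negative degree. *)
Lemma small_degree_curve f (lambda : C) (K : R) phi psi :
  1 <= K -> (forall x y, K <= modulus y -> K * modulus x <= modulus y ->
    2^-1 <= modulus (eval2 f x y - lambda)) ->
  meromorphic_infty phi -> meromorphic_infty psi ->
  (0 < mdeg2 phi psi)%E -> (mdeg (comp2 (f - lambda%:P%:P) phi psi) < 0)%E ->
  exists e : int, [/\ 0 < e, mdeg2 phi psi = e%:~R%:E, growth_le e phi, growth_ge e phi &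
    growth_le e psi /\ growth_le (-1) (comp2 (f - lambda%:P%:P) phi psi)].
Proof.
have mx (u v : \bar R) : (u <= maxe u v)%E /\ (v <= maxe u v)%E.
  by rewrite !le_max !lexx orbT.
have mx' (u v w : \bar R) : maxe u v = w -> (u < w)%E -> v = w.
  by case: (leP u v) => // _ ->; rewrite ltxx.
move=> K1 hK mphi mpsi pos neg.
have mh := meromorphic_comp2 (f - lambda%:P%:P) mphi mpsi.
have Oh : growth_le (-1) (comp2 (f - lambda%:P%:P) phi psi).
  apply/mdeg_leP => //; case: (mdeg_of_int mh) neg => [->|[m ->]]; first by rewrite leNye.
  by rewrite lte_fin lee_fin ltrz0 ler_int; lia.
have [e he] : exists e : int, mdeg2 phi psi = e%:~R%:E.
  move: pos; rewrite /mdeg2; case: (leP (mdeg phi) (mdeg psi)) => _ pos.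
    by case: (mdeg_of_int mpsi) => [h|[m h]]; [rewrite h in pos|exists m].
  by case: (mdeg_of_int mphi) => [h|[m h]]; [rewrite h in pos|exists m].
have e0 : 0 < e by move: pos; rewrite he lte_fin ltr0z.
have Ophi : growth_le e phi by apply: (mdeg_leP e mphi).1; rewrite -he; exact: (mx _ _).1.
have Opsi : growth_le e psi by apply: (mdeg_leP e mpsi).1; rewrite -he; exact: (mx _ _).2.
suff Omphi : growth_ge e phi by exists e; split.
apply: (mdeg_geP e mphi).1; rewrite leNgt; apply/negP => phie.
have hpsi : mdeg psi = e%:~R%:E := mx' _ _ _ he phie.
have Opsi' : growth_ge e psi by apply: (mdeg_geP e mpsi).1; rewrite hpsi.
have Ophi' : growth_le (e - 1) phi.
  apply: (mdeg_leP (e - 1) mphi).1.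
  case: (mdeg_of_int mphi) phie => [->|[m ->]]; first by rewrite leNye.
  by rewrite lte_fin lee_fin ltr_int ler_int; lia.
case: Opsi' Ophi' Oh => [A A0 hA] [B B0 hB] [K' K'0 hK'].
suff /near_pow_le : near_infty (fun t : C => 2^-1 * modulus t ^ 0 <= K' * modulus t ^ (-1)).
  by rewrite invr_gt0 ltr0n => /(_ isT).
have K0 : 0 < K by rewrite (lt_le_trans _ K1).
apply: filterS3 (filterI hA hB) hK' (filterI (near_infty_gt 1)
  (filterI (near_infty_gt (K / A)) (near_infty_gt (K * B / A)))).
move=> t [a b] k [t1 [tK tKB]]; rewrite expr0z mulr1; apply: le_trans k.
have tp : 0 < modulus t by rewrite (lt_trans _ t1).
move: tK tKB; rewrite !ltr_pdivrMr // => tK tKB.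
rewrite /comp2 eval2_subC; apply: hK.
  apply: le_trans a; apply: le_trans (ltW tK) _.
  rewrite mulrC ler_pM2l // -[leLHS]expr1z ler_weXz2l // ltW //.
apply: le_trans a; apply: le_trans (ler_wpM2l (ltW K0) b) _.
have -> : modulus t ^ e = modulus t * modulus t ^ (e - 1).
  by rewrite -[X in X * _]expr1z -expfzDr ?gt_eqF // addrC subrK.
rewrite !mulrA ler_pM2r ?exprz_gt0 // [A * _]mulrC; exact: ltW.
Qed.

End Bounds.

(** * The two inequalities for the exponent at lambda *)

Section MainEstimates.
Variable R : realType.
Local Notation C := R[i].
Implicit Types (phi psi : C -> C) (f : {poly {poly C}}) (t x y : C).

#[local] Opaque mdeg.

Lemma mdeg_Xn D : mdeg (fun t : C => t ^+ D) = (D%:R : R)%:E.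
Proof.
have m := meromorphicXn R D.
rewrite (_ : D%:R = (D%:Z)%:~R) ?pmulrn //; apply/eqP; rewrite eq_le; apply/andP; split.
  apply: (mdeg_leP _ m).2; exists 1 => //; apply: filterE => t.
  by rewrite modulusX mul1r exprnP.
apply: (mdeg_geP _ m).2; exists 1 => //; apply: filterE => t.
by rewrite modulusX mul1r exprnP.
Qed.

Lemma meromorphic_prod (I : Type) (s : seq I) (P : pred I) (F : I -> C -> C) :
  (forall i, meromorphic_infty (F i)) ->
  meromorphic_infty (fun t => \prod_(i <- s | P i) F i t) /\
  mdeg (fun t => \prod_(i <- s | P i) F i t) = (\sum_(i <- s | P i) mdeg (F i))%E.
Proof.
move=> hF; elim: s => [|i s [mI dI]].
  rewrite big_nil (_ : (fun t => \prod_(i <- [::] | P i) F i t) = (fun t => t ^+ 0)); last first.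
    by apply/funext => t; rewrite big_nil expr0.
  by rewrite mdeg_Xn; split=> //; exact: meromorphicXn.
have [Pi|Pi] := boolP (P i).
  have -> : (fun t => \prod_(k <- i :: s | P k) F k t) =
      (fun t => F i t * \prod_(k <- s | P k) F k t).
    by apply/funext => t; rewrite big_cons Pi.
  rewrite big_cons Pi; split; first exact: (meromorphicM (hF i) mI).
  by rewrite -dI; exact: (mdegM (hF i) mI).
have -> : (fun t => \prod_(k <- i :: s | P k) F k t) = (fun t => \prod_(k <- s | P k) F k t).
  by apply/funext => t; rewrite big_cons (negPf Pi).
by rewrite big_cons (negPf Pi).
Qed.

(** Integer degrees differ by at least 1, and a factor |t| beats any constant K. *)
Lemma mdeg_lt_dominates phi psi (K : R) : 0 < K ->
  meromorphic_infty phi -> meromorphic_infty psi -> (mdeg phi < mdeg psi)%E ->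
  near_infty (fun t => K * modulus (phi t) < modulus (psi t)).
Proof.
move=> K0 mphi mpsi.
case: (meromorphic_cases mpsi) => [[_ ->]|[d [a [L [ga hd]]]]]; first by rewrite ltNge leNye.
have [_ [A A0 hA]] := germ_bounds ga => lt.
have Op : growth_le (d - 1) phi.
  apply: (mdeg_leP (d - 1) mphi).1; move: lt; rewrite hd.
  case: (mdeg_of_int mphi) => [->|[m ->]]; first by rewrite leNye.
  by rewrite lte_fin lee_fin ltr_int ler_int; lia.
case: Op => B B0 hB.
apply: filterS3 hA hB (filterI (near_infty_gt 1) (near_infty_gt (K * B / A))).
move=> t a1 b1 [t1 tK]; have tp : 0 < modulus t by rewrite (lt_trans _ t1).
apply: lt_le_trans a1; apply: le_lt_trans (ler_wpM2l (ltW K0) b1) _.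
have -> : modulus t ^ d = modulus t * modulus t ^ (d - 1).
  by rewrite -[X in X * _]expr1z -expfzDr ?gt_eqF // addrC subrK.
rewrite !mulrA ltr_pM2r ?exprz_gt0 // [A * _]mulrC.
by move: tK; rewrite ltr_pdivrMr.
Qed.

(** At each t the index j may be different. If no j satisfied the degree inequality, then for every
    j the distance from gamma_j to beta_i would eventually exceed 2^m |beta_i - beta_l|; with
    finitely many j this happens at a common t and contradicts the pointwise statement. *)
Lemma exists_near_critical_point n m (beta : 'I_n -> C -> C) (gamma : 'I_m -> C -> C)
    (c : C) (i l : 'I_n) : i != l -> c != 0 ->
  (forall k, meromorphic_infty (beta k)) -> (forall j, meromorphic_infty (gamma j)) ->
  near_infty (fun t => (\prod_k ('X - (beta k t)%:P))^`() =
     c *: \prod_j ('X - (gamma j t)%:P)) ->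
  exists j, (mdeg (fun t => (gamma j t - beta i t)%R) <=
             mdeg (fun t => (beta i t - beta l t)%R))%E.
Proof.
move=> il c0 mb mg h; apply/not_existsP => far.
have {far} far j : near_infty (fun t =>
    2 ^+ m * modulus (beta i t - beta l t) < modulus (gamma j t - beta i t)).
  apply: mdeg_lt_dominates; rewrite ?exprn_gt0 //; try exact: meromorphicB.
  by rewrite ltNge; apply/negP; exact: far.
have far' := @filter_forall _ _ _ _ (@filter_filter _ _ (near_infty_proper R)) far.
have [t [ht ft]] := @filter_ex _ _ (near_infty_proper R) _ (filterI h far').
have [j] := critical_point_near_roots il c0 ht.
by rewrite [modulus (beta l t - _)]modulusB leNgt ft.
Qed.

Lemma lojasiewicz_at_le f (lambda : C) n m D (beta : 'I_n -> C -> C)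
    (gamma : 'I_m -> C -> C) (i l : 'I_n) :
  (0 < D)%N -> (1 < n)%N ->
  (forall k, meromorphic_infty (beta k)) -> (forall j, meromorphic_infty (gamma j)) ->
  (forall j, (mdeg (gamma j) <= D%:R%:E)%E) ->
  near_infty (fun t => forall y,
    eval2 f (t ^+ D) y - lambda = \prod_(k < n) (y - beta k t)) ->
  near_infty (fun t => forall y,
    eval2 f^`() (t ^+ D) y = n%:R * \prod_(j < m) (y - gamma j t)) ->
  l != i -> (forall k, k != i -> mdeg (fun t => (beta i t - beta l t)%R) <=
                   mdeg (fun t => (beta i t - beta k t)%R))%E ->
  let W := (\sum_(k < n | k != i) mdeg (fun t => (beta i t - beta k t)%R)
            + mdeg (fun t => (beta i t - beta l t)%R))%E in
  (W < 0)%E -> (lojasiewicz_infty_at f lambda + 1 <= (D%:R^-1)%:E * W)%E.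
Proof.
move=> D0 n1 mb mg dg hf hfy li lmin W W0.
have nC : (n%:R : C) != 0 by rewrite pnatr_eq0 -lt0n ltnW.
have il : i != l by rewrite eq_sym.
have hP : near_infty (fun t => (\prod_k ('X - (beta k t)%:P))^`() =
    (n%:R : C) *: \prod_j ('X - (gamma j t)%:P)).
  apply: filterS2 (near_eval2_roots hf) hfy => t h1 h2; apply: poly_ext_horner => y.
  rewrite -h1 h2 hornerZ horner_prod; congr (_ * _).
  by apply: eq_bigr => j _; rewrite hornerXsubC.
have [j hj] := exists_near_critical_point il nC mb mg hP.
pose X (t : C) := t ^+ D.
have mX : meromorphic_infty X := meromorphicXn R D.
have dX : mdeg X = (D%:Z%:~R : R)%:E by rewrite /X mdeg_Xn.
set h := comp2 (f - lambda%:P%:P) X (gamma j).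
have mh : meromorphic_infty h := meromorphic_comp2 _ mX (mg j).
have mB k := meromorphicB (mb i) (mb k).
have mG k := meromorphicB (mg j) (mb k).
have hW : (mdeg h <= W)%E.
  have -> : mdeg h = mdeg (fun t => \prod_k (gamma j t - beta k t)).
    by apply: near_mdeg; apply: filterS hf => t ht; rewrite /h /comp2 eval2_subC ht.
  have -> : mdeg (fun t => \prod_k (gamma j t - beta k t)) = _ :=
    (meromorphic_prod (index_enum 'I_n) xpredT mG).2.
  have -> : (\sum_k mdeg (fun t => gamma j t - beta k t)%R =
      mdeg (fun t => gamma j t - beta i t)%R +
      \sum_(k < n | k != i) mdeg (fun t => gamma j t - beta k t)%R)%E := bigD1 i isT.
  (* Ultrametric inequality: gamma_j - beta_k is the sum of gamma_j - beta_i, of degree at most deg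
     (beta_i - beta_l), and of beta_i - beta_k; the minimality of l bounds both by deg (beta_i -
     beta_k). *)
  rewrite addeC; apply: leeD (hj); apply: lee_sum => k ki.
  have -> : mdeg (fun t => gamma j t - beta k t) =
      mdeg (fun t => (gamma j t - beta i t) + (beta i t - beta k t)).
    by apply: near_mdeg; apply: filterE => t; ring.
  apply: le_trans (mdegD (mG i) (mB k)) _.
  rewrite ge_max; apply/andP; split; last exact: lexx.
  exact: le_trans (hj) (lmin k ki).
have fy0 : near_infty (fun t => comp2 f^`() X (gamma j) t = 0).
  apply: filterS hfy => t ht; rewrite /comp2 /X ht (bigD1 j) //= subrr mul0r mulr0.
  by [].
have mfx := meromorphic_comp2 (derivx f) mX (mg j).
have OX : growth_le D X by apply: (mdeg_leP _ mX).1; rewrite dX.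
have Og : growth_le D (gamma j) by apply: (mdeg_leP _ (mg j)).1; exact: dg.
have Dn0 : (D%:Z : int) != 0 by rewrite eqz_nat -lt0n.
have dfx (q : int) : (W <= q%:~R%:E)%E ->
    (mdeg (comp2 (derivx f) X (gamma j)) <= (q - D%:Z)%:~R%:E)%E.
  move=> Wq; apply: (mdeg_leP _ mfx).2; rewrite -(derivx_subC f lambda).
  have fy0' : near_infty (fun t => comp2 (f - lambda%:P%:P)^`() X (gamma j) t = 0).
    by rewrite deriv_subC.
  have Oh : growth_le q h := (mdeg_leP q mh).1 (le_trans hW Wq).
  exact: (@growth_le_derivx R (f - lambda%:P%:P) X (gamma j) D%:Z q D%:Z
    mX (mg j) OX Og (le0z_nat D) dX Dn0 fy0' Oh).
set G := mdeg (comp2 (derivx f) X (gamma j)) in dfx *.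
have lojG : (lojasiewicz_infty_at f lambda <= G * (D%:R^-1)%:E)%E.
  have dXg : mdeg2 X (gamma j) = (D%:R)%:E.
    by rewrite /mdeg2 max_l ?dX //; exact: dg.
  apply: ereal_inf_lbound; exists X, (gamma j); split; [exact: mX|exact: mg| | |].
  - by rewrite dXg lte_fin ltr0n.
  - exact: le_lt_trans hW W0.
  - rewrite dXg /mdeg2 (mdeg_near0 fy0) maxeNy inver.
    by rewrite (_ : (D%:R == 0) = false) // pnatr_eq0 gtn_eqF.
have DR : 0 < D%:R :> R by rewrite ltr0n.
have Wint : W = -oo%E \/ exists w : int, W = w%:~R%:E.
  pose Z u := u = -oo%E \/ exists w : int, u = (w%:~R : R)%:E.
  have ZD u v : Z u -> Z v -> Z (u + v)%E.
    move=> [->|[m1 ->]] [->|[m2 ->]]; rewrite /Z ?addNye ?addeNy; try by left.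
    by right; exists (m1 + m2); rewrite rmorphD.
  have ZB k : Z (mdeg (fun t => beta i t - beta k t)) by exact: mdeg_of_int (mB k).
  apply: (ZD _ _ _ (ZB l)); apply: (big_ind Z); [by right; exists 0|exact: ZD|].
  by move=> k _; exact: ZB.
have Gint : G = -oo%E \/ exists w : int, G = w%:~R%:E := mdeg_of_int mfx.
(* If W is [-oo], [dfx] holds for every integer q; a finite degree p of f_x would give p <= p - 1 at
   q = p + D - 1. *)
case: Wint => [WE|[w WE]].
  have GE : G = -oo%E.
    case: Gint => // -[p GE]; have := dfx (p + D%:Z - 1); rewrite WE leNye => /(_ isT).
    by rewrite GE lee_fin ler_int; lia.
  move: lojG; rewrite GE mulNyr gtr0_sg ?invr_gt0 // mul1e leeNy_eq => /eqP ->.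
  by rewrite addNye leNye.
have := dfx w; rewrite WE lexx => /(_ isT) hG.
have hG' : (G * (D%:R^-1)%:E <= ((w - D%:Z)%:~R / D%:R)%:E)%E.
  by rewrite EFinM; apply: lee_wpmul2r hG; rewrite lee_fin invr_ge0 ltW.
apply: le_trans (leeD (le_trans lojG hG') (lexx 1%E)) _.
rewrite -EFinD -EFinM lee_fin rmorphB /= -[D%:~R]pmulrn.
by rewrite mulrBl divff ?gt_eqF // subrK mulrC.
Qed.

Lemma lojasiewicz_at_ge f (lambda : C) n D (beta : 'I_n.+1 -> C -> C)
    (d : 'I_n.+1 -> 'I_n.+1 -> int) (M : int) (K : R) :
  (0 < D)%N -> M < 0 -> 1 <= K ->
  (forall x y, K <= modulus y -> K * modulus x <= modulus y ->
    2^-1 <= modulus (eval2 f x y - lambda)) ->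
  near_infty (fun t => forall y,
    eval2 f (t ^+ D) y - lambda = \prod_(i < n.+1) (y - beta i t)) ->
  (forall i j, j != i -> growth_ge (d i j) (fun t => beta i t - beta j t)) ->
  (forall i, exists m, [/\ forall j, j != i -> m <= d i j,
     M <= \sum_(j < n.+1 | j != i) d i j + m &
     M - D%:Z <= \sum_(j < n.+1 | j != i) d i j]) ->
  ((M%:~R / D%:R - 1)%:E <= lojasiewicz_infty_at f lambda)%E.
Proof.
have mx (u v w : \bar R) : maxe u v = w -> (u <= w /\ v <= w)%E.
  by move=> <-; rewrite !le_max !lexx orbT.
have mx' (u v : \bar R) : maxe u v = u \/ maxe u v = v.
  by case: (leP u v); [right|left].
move=> D0 M0 K1 hK hf hd hM.
apply/ereal_infP => _ [phi [psi [mphi mpsi pos neg ->]]].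
have [e [e0 he Ophi Omphi [Opsi Oh]]] := small_degree_curve K1 hK mphi mpsi pos neg.
have eR : 0 < (e%:~R : R) by rewrite ltr0z.
have DR : 0 < (D%:R : R) by rewrite ltr0n.
have mfx := meromorphic_comp2 (derivx f) mphi mpsi.
have mfy := meromorphic_comp2 f^`() mphi mpsi.
have bound (p : int) : (mdeg2 (comp2 (derivx f) phi psi) (comp2 f^`() phi psi) <= p%:~R%:E)%E ->
    e * M <= (p + e) * D%:Z.
  move=> Gp; have [g1 g2] :=
    mx (mdeg (comp2 (derivx f) phi psi)) (mdeg (comp2 f^`() phi psi)) _ erefl.
  apply: (lojasiewicz_at_int_ge D0 hf hd hM mphi mpsi e0 Ophi Omphi Opsi Oh).
    exact: (mdeg_leP p mfx).1 (le_trans g1 Gp).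
  exact: (mdeg_leP p mfy).1 (le_trans g2 Gp).
rewrite he inver gt_eqF //; set G := mdeg2 _ _ in bound *.
have [GE|[p GE]] : G = -oo%E \/ exists p : int, G = p%:~R%:E.
  by case: (mx' (mdeg (comp2 (derivx f) phi psi)) (mdeg (comp2 f^`() phi psi))) => E;
    rewrite /G /mdeg2 E; [exact: (mdeg_of_int mfx)|exact: (mdeg_of_int mfy)].
  (* A gradient vanishing along the curve would satisfy the bound for every p. This p gives e M <=
     (e M - 1) D <= e M - 1, as e M - 1 is negative and D >= 1. *)
  have := bound (e * M - 1 - e); rewrite GE leNye subrK => /(_ isT) le1.
  have eM : e * M - 1 <= 0 by have := ltr_pM2l e0 M 0; rewrite mulr0 M0; lia.
  have le2 : (e * M - 1) * D%:Z <= (e * M - 1) * 1.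
    by rewrite ler_wnM2l // lez_nat.
  by move: (le_trans le1 le2); rewrite mulr1; lia.
have := bound p; rewrite GE lexx => /(_ isT) le1.
rewrite -EFinM lee_fin lerBlDr -[X in _ + X](divff (lt0r_neq0 eR)) -mulrDl.
rewrite ler_pdivrMr // mulrAC ler_pdivlMr // -rmorphD /=.
have := le1; rewrite -(ler_int R) !rmorphM /= -[D%:~R]pmulrn mulrC; exact.
Qed.

Lemma growth_leB q phi psi : growth_le q phi -> growth_le q psi ->
  growth_le q (fun t => phi t - psi t).
Proof.
move=> [K K0 h] [K' K'0 h']; exists (K + K'); first by rewrite addr_gt0.
apply: filterS2 h h' => t ht ht'; apply: le_trans (modulusBD _ _) _.
by rewrite mulrDl lerD.
Qed.

Lemma bigmin_attained (I : finType) (P : pred I) (F : I -> \bar R) (j : I) : P j ->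
  exists l, [/\ P l, \big[mine/+oo%E]_(i | P i) F i = F l &
    forall k, P k -> (F l <= F k)%E].
Proof.
move=> Pj; exists [arg min_(i < j | P i) F i]%O; split.
- by case: Order.TotalTheory.arg_minP.
- by apply: bigmin_eq_arg => // i _; rewrite leey.
- by case: Order.TotalTheory.arg_minP => // i _ h k Pk; exact: h.
Qed.

End MainEstimates.


Theorem corollary3p7 (R : realType) (n : nat) (n_gt1 : (1 < n)%N)
    (a : nat -> {poly R[i]})
    (deg_a : forall i : nat, (1 <= i <= n)%N -> (size (a i) <= i.+1)%N)
    (f : {poly {poly R[i]}})
    (f_def : f = 'X^n + \sum_(1 <= i < n.+1) (a i)%:P * 'X^(n - i))
    (lambda0 : R[i])
    (D : nat) (D_gt0 : (0 < D)%N)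
    (beta : 'I_n -> R[i] -> R[i]) (gamma : 'I_n.-1 -> R[i] -> R[i])
    (mero_beta : forall i, meromorphic_infty (beta i))
    (mero_gamma : forall j, meromorphic_infty (gamma j))
    (deg_beta : forall i, (mdeg (beta i) <= D%:R%:E)%E)
    (deg_gamma : forall j, (mdeg (gamma j) <= D%:R%:E)%E)
    (fact_f : near_infty (fun t => forall y : R[i],
       eval2 f (t ^+ D) y - lambda0 = \prod_(i < n) (y - beta i t)))
    (fact_fy : near_infty (fun t => forall y : R[i],
       eval2 f^`() (t ^+ D) y = n%:R * \prod_(j < n.-1) (y - gamma j t)))
    (loj_lt0 : (lojasiewicz_infty
       [tuple (f - lambda0%:P%:P)%R; f^`()%R] < 0)%E) :
  (lojasiewicz_infty_at f lambda0 + 1 =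
   (D%:R^-1)%:E *
   \big[mine/+oo]_(i < n)
     (\sum_(j < n | j != i) mdeg (fun t => (beta i t - beta j t)%R)
      + \big[mine/+oo]_(j < n | j != i) mdeg (fun t => (beta i t - beta j t)%R)))%E.
Proof.
have [n' nE] : exists n', n = n'.+1 by exists n.-1; rewrite prednK // ltnW.
subst n.
have [K K1 hK] : exists2 K : R, 1 <= K & forall x y, K <= modulus y ->
    K * modulus x <= modulus y -> 2^-1 <= modulus (eval2 f x y - lambda0).
  have [K K1 hK] := monic_dominates lambda0 (ltn0Sn n') deg_a.
  exists K => // x y Ky Kxy; apply: le_trans (_ : 2^-1 * modulus y ^+ n'.+1 <= _).
    by rewrite ler_peMr ?invr_ge0 // exprn_ege1 // (le_trans K1).
  by rewrite f_def; exact: hK.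
pose dd i j := mdeg (fun t => beta i t - beta j t).
have mB i j : meromorphic_infty (fun t => beta i t - beta j t) :=
  meromorphicB (mero_beta i) (mero_beta j).
pose S i := (\sum_(j < n'.+1 | j != i) dd i j)%E.
pose mm i := (\big[mine/+oo]_(j < n'.+1 | j != i) dd i j)%E.
rewrite -[X in (_ = _ * X)%E]/(\big[mine/+oo]_(i < n'.+1) (S i + mm i))%E.
have /choice[l hl] i : exists l, [/\ l != i, mm i = dd i l &
    forall k, k != i -> (dd i l <= dd i k)%E].
  (* As n > 1, no inner minimum is taken over an empty set, so the neutral value [+oo] is never the
     result. *)
  have [j ji] : exists j : 'I_n'.+1, j != i.
    have [i0|] := eqVneq i ord0; last by exists ord0; rewrite eq_sym.
    by exists ord_max; rewrite i0 -val_eqE /= -lt0n.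
  exact: (@bigmin_attained R _ (fun k => k != i) (dd i) j ji).
have [i0 [_ VE Vmin]] := @bigmin_attained R _ xpredT (fun i => S i + mm i)%E ord0 isT.
rewrite VE; have [li0 mE lmin] := hl i0.
have up : (S i0 + mm i0 < 0)%E ->
    (lojasiewicz_infty_at f lambda0 + 1 <= (D%:R^-1)%:E * (S i0 + mm i0))%E.
  by rewrite mE; exact: (lojasiewicz_at_le D_gt0 n_gt1 mero_beta mero_gamma
    deg_gamma fact_f fact_fy li0 lmin).
have DR : 0 < D%:R^-1 :> R by rewrite invr_gt0 ltr0n.
(* Two roots equal near infinity make the right-hand side [-oo], and the upper bound forces the
   left-hand side to be [-oo] too. Otherwise all degrees between distinct indices are integers. *)
have [[i [j [ji dij]]]|fin] := pselect (exists i j, j != i /\ dd i j = -oo%E).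
  have VN : (S i0 + mm i0)%E = -oo%E.
    apply/eqP; rewrite -leeNy_eq; apply: le_trans (Vmin i isT) _.
    have [_ -> h] := hl i; have hj := h j ji; rewrite dij leeNy_eq in hj; rewrite (eqP hj).
    by rewrite addeNy.
  have := up; rewrite VN ltNy0 => /(_ isT).
  by rewrite mulrNy gtr0_sg // mul1e leeNy_eq => /eqP.
(* The default 0 is taken on the diagonal, where the degree is [-oo]. *)
have /choice[d hd] (p : 'I_n'.+1 * 'I_n'.+1) : exists m : int, p.2 != p.1 ->
    dd p.1 p.2 = m%:~R%:E.
  case: (mdeg_of_int (mB p.1 p.2)) => [E|[m E]]; last by exists m.
  by exists 0 => pp; case: fin; exists p.1, p.2.
have hd' i j : j != i -> growth_ge (d (i, j)) (fun t => beta i t - beta j t).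
  by move=> ji; apply: (mdeg_geP _ (mB i j)).1; rewrite -(hd (i, j) ji).
have SE i : S i = (\sum_(j < n'.+1 | j != i) d (i, j))%:~R%:E.
  rewrite /S rmorph_sum /= -sumEFin; apply: eq_bigr => j ji; exact: hd (i, j) ji.
have VEi i : (S i + mm i)%E = (\sum_(j < n'.+1 | j != i) d (i, j) + d (i, l i))%:~R%:E.
  have [li -> _] := hl i; rewrite SE (hd (i, l i) li) -EFinD -rmorphD.
  by [].
have dmin i j : j != i -> d (i, l i) <= d (i, j).
  move=> ji; have [li _ h] := hl i; have := h j ji.
  by rewrite (hd (i, l i) li) (hd (i, j) ji) lee_fin ler_int.
pose M := \sum_(j < n'.+1 | j != i0) d (i0, j) + d (i0, l i0).
have MV i : M <= \sum_(j < n'.+1 | j != i) d (i, j) + d (i, l i).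
  have [V hV] : exists V, forall k, V k = (S k + mm k)%E :=
    ex_intro _ (fun k => S k + mm k)%E (fun k => erefl).
  have VZ k := etrans (hV k) (VEi k).
  have : (V i0 <= V i)%E by rewrite (hV i0) (hV i); exact (Vmin i isT).
  by rewrite (VZ i0) (VZ i) lee_fin ler_int.
(* Roots of degree at most D give m_i <= D, hence S_i >= M - m_i >= M - D, the exponent used for f_y
   in the lower bound. *)
have dD i : d (i, l i) <= D%:Z.
  have [li _ _] := hl i; apply: growth_le_ge (hd' i (l i) li).
  by apply: growth_leB; apply: (mdeg_leP D%:Z (mero_beta _)).1; exact: deg_beta.
have M0 : M < 0.
  rewrite ltNge; apply/negP => M0; move: loj_lt0; rewrite ltNge => /negP[].
  apply: (lojasiewicz_infty_ge0 D_gt0 K1 hK fact_f hd') => i.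
  exists (d (i, l i)); split; [exact: dmin|exact: le_trans (MV i)|].
  (* S_i >= 0 in both cases: if m_i >= 0 all its terms are nonnegative, and otherwise S_i >= M - m_i
     >= - m_i. *)
  have [p|p] := leP 0 (d (i, l i)).
    by apply: sumr_ge0 => j ji; exact: le_trans (dmin i j ji).
  have := le_trans M0 (MV i); rewrite -lerBlDr sub0r; apply: le_trans.
  by rewrite oppr_ge0 ltW.
apply/eqP; rewrite eq_le; apply/andP; split.
  by apply: up; rewrite (VEi i0) lte_fin ltrz0.
have hM i : exists m, [/\ forall j, j != i -> m <= d (i, j),
     M <= \sum_(j < n'.+1 | j != i) d (i, j) + m &
     M - D%:Z <= \sum_(j < n'.+1 | j != i) d (i, j)].
  exists (d (i, l i)); split; [exact: dmin|exact: MV|].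
  by rewrite lerBlDr; apply: le_trans (MV i) _; rewrite lerD2l.
have := lojasiewicz_at_ge D_gt0 M0 K1 hK fact_f hd' hM.
rewrite (VEi i0) -EFinM -/M => lo.
apply: le_trans (leeD lo (lexx 1%E)).
by rewrite -EFinD subrK lee_fin mulrC.
Qed.
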